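(* For $A\in\mathcal{M}_2(\mathbb{C})\setminus\{0_2\}$ and $B_1,B_2,C\in\mathcal{M}_2(\mathbb{C})$, consider the equation $$XAX+B_1X+XB_2+C=0_2\qquad\text{in the unknown }X\in\mathcal{M}_2(\mathbb{C}).$$ For each of the following forms, there exist matrices $A\neq 0_2,B_1,B_2,C$ such that the set of solutions in $\mathcal{M}_2(\mathbb{C})$ (that is, not at infinity) of the associated equation is of that form: (i) $0,1,\dots,$ or $6$ elements (each of these numbers occurring); (ii) an algebraic set of dimension $1$; (iii) an algebraic set of dimension $2$. Conversely, for all $A\in\mathcal{M}_2(\mathbb{C})\setminus\{0_2\}$ and $B_1,B_2,C\in\mathcal{M}_2(\mathbb{C})$, the set of solutions of the equation has one of the previous three forms.
   Context: The matrix equation is regarded as a system of $4$ polynomial equations in the $4$ complex entries of $X$; its solution set is an algebraic subset of $\mathbb{C}^4$. *)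

(* Defs.v *)
From mathcomp Require Import all_boot all_order all_algebra.
From mathcomp Require Import boolp classical_sets functions cardinality reals.
From mathcomp Require Import complex mpoly.

Set Implicit Arguments.
Unset Strict Implicit.
Unset Printing Implicit Defensive.

Import GRing.Theory.
Local Open Scope ring_scope.
Local Open Scope classical_set_scope.

Section ZariskiDimension.
Variables (K : fieldType) (n : nat).

Definition zero_locus (S : set {mpoly K[n]}) : set 'rV[K]_n :=
  [set v | forall p, S p -> p.@[fun i => v 0 i] = 0].

Definition algebraic_set (V : set 'rV[K]_n) : Prop :=
  exists S : set {mpoly K[n]}, V = zero_locus S.

Definition irreducible_algebraic_set (Z : set 'rV[K]_n) : Prop :=
  [/\ algebraic_set Z, Z !=set0 &
      forall Z1 Z2, algebraic_set Z1 -> algebraic_set Z2 ->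
        Z = Z1 `|` Z2 -> Z = Z1 \/ Z = Z2].

(* Strict chains Z_0 < ... < Z_d of irreducible algebraic sets inside V; only
   the values Z i with i <= d matter. *)
Definition irreducible_chain (V : set 'rV[K]_n) (d : nat)
    (Z : nat -> set 'rV[K]_n) : Prop :=
  [/\ forall i, (i <= d)%N -> irreducible_algebraic_set (Z i),
      forall i, (i <= d)%N -> Z i `<=` V &
      forall i, (i < d)%N -> Z i `<` Z i.+1].

(* Krull dimension for the Zariski topology.  As V is itself Zariski closed,
   its closed subsets are the algebraic sets contained in V.  V need not be
   equidimensional. *)
Definition algebraic_set_of_dim (V : set 'rV[K]_n) (d : nat) : Prop :=
  [/\ algebraic_set V,
      exists Z, irreducible_chain V d Z &
      forall e Z, irreducible_chain V e Z -> (e <= d)%N].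

End ZariskiDimension.

Definition riccati_solutions (K : fieldType) (A B1 B2 C : 'M[K]_2) :
    set 'M[K]_2 :=
  [set X | X *m A *m X + B1 *m X + X *m B2 + C = 0].

(* mxvec lists the entries of a 2 x 2 matrix row by row, which identifies
   'M_2 with the affine space of dimension 4 = 2 * 2. *)
Definition matrix_algebraic_set_of_dim (K : fieldType) (V : set 'M[K]_2)
    (d : nat) : Prop :=
  algebraic_set_of_dim (mxvec @` V) d.

(* Main.v *)
Require Import Defs.
From mathcomp Require Import all_boot all_order all_algebra.
From mathcomp Require Import boolp classical_sets functions cardinality reals.
From mathcomp Require Import complex mpoly.
From mathcomp Require Import zify ring.

(* Around a solution X0 the equation becomes Y A Y + P Y + Y Q = 0.  An
   invertible Y is a solution iff A + Z P + Q Z = 0 for Z = Y^-1, an affine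
   condition: two such solutions give a rational curve of solutions.  A solution
   Y = u v^T of rank one requires u to be an eigenvector of P and v one of Q^T;
   given the lines of u and v, either Y A Y = 0 and all multiples of Y are
   solutions, or Y is determined.  If P or Q is scalar, u or v can be moved along
   a line.  Hence either there is a curve of solutions, or there are at most
   1 + 1 + 2 * 2 = 6 solutions.

   A strict chain of irreducible sets of length d produces d polynomials whose
   monomials stay independent on the largest set, so the space of functions
   induced by polynomials of degree <= N grows at least like N^d.  With A in
   normal form (A = diag(1, 0) or A = 1), rewriting with the four equations leaves
   O(N^2) standard monomials of degree <= N, so chains have length at most 2. *)

Set Implicit Arguments.
Unset Strict Implicit.
Unset Printing Implicit Defensive.

Import GRing.Theory.
Local Open Scope ring_scope.
Local Open Scope classical_set_scope.
Local Open Scope card_scope.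

(** * Irreducible sets and rational curves *)

Local Notation mev p v := (p.@[fun i => v 0 i]).

Definition vanishes (K : fieldType) n (Z : set 'rV[K]_n) (p : {mpoly K[n]}) :=
  forall v, Z v -> mev p v = 0.

Definition zariski_closure (K : fieldType) n (D : set 'rV[K]_n) :=
  zero_locus (vanishes D).

Lemma sub_zariski_closure (K : fieldType) n (D : set 'rV[K]_n) :
  D `<=` zariski_closure D.
Proof. by move=> v Dv p; apply. Qed.

Lemma zariski_closure_min (K : fieldType) n (D V : set 'rV[K]_n) :
  algebraic_set V -> D `<=` V -> zariski_closure D `<=` V.
Proof.
move=> [S ->] DV v clv p Sp; apply: clv => w Dw.
exact: DV Dw _ Sp.
Qed.

Lemma algebraic_setI_hypersurface (K : fieldType) n (Z : set 'rV[K]_n) p :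
  algebraic_set Z -> algebraic_set (Z `&` [set v | mev p v = 0]).
Proof.
move=> [S ->]; exists (S `|` [set p]); apply/seteqP; split => v /=.
- by move=> [Sv pv] q [/Sv //|/= ->].
- by move=> Sv; split=> [q Sq|]; apply: Sv; [left|right].
Qed.

(** [Z] is the union of its sections by the hypersurfaces [p = 0] and [q = 0], so irreducibility
    makes one of them all of [Z]: the ideal of [Z] is prime. *)
Lemma vanishes_prime (K : fieldType) n (Z : set 'rV[K]_n) p q :
  irreducible_algebraic_set Z -> vanishes Z (p * q) ->
  vanishes Z p \/ vanishes Z q.
Proof.
move=> [algZ _ irrZ] pqZ.
have := irrZ _ _ (algebraic_setI_hypersurface p algZ)
  (algebraic_setI_hypersurface q algZ).
case.
- apply/seteqP; split => v; last by move=> [[]|[]].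
  move=> Zv; move/(_ v Zv)/eqP: pqZ; rewrite mevalM mulf_eq0.
  by case/orP => /eqP; [left|right].
- by move=> ->; left => v [].
- by move=> ->; right => v [].
Qed.

(** Characteristic zero supplies [size p] distinct integers, more than [p] can have roots. *)
Lemma poly_nonroot (K : numFieldType) (p : {poly K}) :
  p != 0 -> exists t, p.[t] != 0.
Proof.
move=> p0; apply: contrapT => /forallNP h.
pose s : seq K := [seq i%:R | i <- iota 0 (size p)].
have : (size s < size p)%N.
  apply: max_poly_roots => //.
    by apply/allP => x _; apply/negPn/negP => /h.
  rewrite map_inj_in_uniq ?iota_uniq // => i j _ _ /eqP.
  by rewrite Num.Theory.eqr_nat => /eqP.
by rewrite size_map size_iota ltnn.
Qed.

Section RationalCurve.
Variables (K : fieldType) (n : nat).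

Definition ratpt (q : {poly K}) (N : 'rV[{poly K}]_n) (t : K) : 'rV[K]_n :=
  \row_i ((N 0 i).[t] / q.[t]).

(** At the roots of the common denominator [q], [ratpt] takes the junk value 0; the guards [q.[t] !=
    0] exclude them. *)
Definition joined_in (D : set 'rV[K]_n) (x y : 'rV[K]_n) :=
  exists q N,
  [/\ forall t, q.[t] != 0 -> D (ratpt q N t),
      exists2 t, q.[t] != 0 & ratpt q N t = x &
      exists2 t, q.[t] != 0 & ratpt q N t = y].

(** Clearing denominators: along the curve [p] is the rational function [P / q ^ k]. *)
Lemma meval_ratpt q N (p : {mpoly K[n]}) : exists (P : {poly K}) (k : nat),
  forall t, q.[t] != 0 -> mev p (ratpt q N t) * q.[t] ^+ k = P.[t].
Proof.
elim/mpolyind: p => [|c m p _ _ [P [k IH]]].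
  by exists 0, 0%N => t _; rewrite meval0 mul0r horner0.
have [P' [k' H']] : exists (P : {poly K}) (k : nat), forall t, q.[t] != 0 ->
    mev 'X_[m] (ratpt q N t) * q.[t] ^+ k = P.[t].
  exists (\prod_i N 0 i ^+ m i), (\sum_i m i)%N => t qt.
  rewrite mevalX horner_prod -prodrXr -big_split /=.
  apply: eq_bigr => i _; rewrite mxE horner_exp -exprMn divfK //.
exists (c%:P * P' * q ^+ k + P * q ^+ k'), (k' + k)%N => t qt.
rewrite mevalD mevalZ !hornerE /= -H' // -IH // exprD.
ring.
Qed.
End RationalCurve.

(** If two smaller algebraic sets covered the closure, some [p] vanishing on the first would be
    non-zero at a point [x] of [D], and some [r] vanishing on the second at a point [y]. Along a
    curve joining [x] to [y] both are non-zero rational functions, so at some parameter neither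
    vanishes, and that point lies in neither set. *)
Lemma irreducible_closure (K : numFieldType) n (D : set 'rV[K]_n) :
  D !=set0 -> (forall x y, D x -> D y -> joined_in D x y) ->
  irreducible_algebraic_set (zariski_closure D).
Proof.
move=> [x0 Dx0] join; split; first by exists (vanishes D).
  by exists x0; apply: sub_zariski_closure.
move=> Z1 Z2 alg1 alg2 eqZ.
have sep Z : algebraic_set Z -> ~ zariski_closure D `<=` Z ->
    exists x p, [/\ D x, vanishes Z p & mev p x != 0].
  move=> algZ nsub; apply: contrapT => h; apply: nsub.
  apply: zariski_closure_min => // x Dx.
  case: algZ h => S -> h p Sp; apply/eqP/negPn/negP => px.
  by apply: h; exists x, p; split=> // v; apply.
apply: contrapT => /not_orP[n1 n2].
have [|x [p [Dx pZ px]]] := sep Z1 alg1.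
  by move=> s; apply: n1; apply/seteqP; split=> // v Zv; rewrite eqZ; left.
have [|y [r [Dy rZ ry]]] := sep Z2 alg2.
  by move=> s; apply: n2; apply/seteqP; split=> // v Zv; rewrite eqZ; right.
have [q [N [ND [t1 q1 e1] [t2 q2 e2]]]] := join x y Dx Dy.
have [P [k HP]] := meval_ratpt q N p.
have [R' [l HR]] := meval_ratpt q N r.
have P0 : P != 0.
  apply: contraNneq px => P0; have := HP _ q1.
  rewrite e1 P0 horner0 => /eqP.
  by rewrite mulf_eq0 expf_eq0 (negPf q1) andbF orbF.
have R0 : R' != 0.
  apply: contraNneq ry => P0'; have := HR _ q2.
  rewrite e2 P0' horner0 => /eqP.
  by rewrite mulf_eq0 expf_eq0 (negPf q2) andbF orbF.
have q0 : q != 0 by apply: contraNneq q1 => ->; rewrite horner0.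
have [|t] := @poly_nonroot K (P * R' * q); first by rewrite !mulf_neq0.
rewrite !hornerM !mulf_eq0 !negb_or -andbA => /and3P[Pt Rt qt].
have : zariski_closure D (ratpt q N t) by apply/sub_zariski_closure/ND.
rewrite eqZ => -[/pZ e|/rZ e].
- by move: Pt; rewrite -HP // e mul0r eqxx.
- by move: Rt; rewrite -HR // e mul0r eqxx.
Qed.

(** The chain is the point [x] inside the closure of the curve, which also contains [y]. *)
Lemma joined_chain1 (K : numFieldType) n (V : set 'rV[K]_n) x y :
  algebraic_set V -> joined_in V x y -> x <> y ->
  exists Z, irreducible_chain V 1 Z.
Proof.
move=> algV [q [N [NV [t1 q1 e1] [t2 q2 e2]]]] xy.
pose D := [set v | exists2 t, q.[t] != 0 & ratpt q N t = v].
have DV : D `<=` V by move=> v [t qt <-]; apply: NV.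
have irrx : irreducible_algebraic_set [set x].
  have -> : [set x] = zariski_closure [set x].
    apply/seteqP; split; first exact: sub_zariski_closure.
    move=> v clv; apply/rowP => i; apply/eqP; rewrite -subr_eq0; apply/eqP.
    have := clv ('X_i - (x 0 i)%:MP).
    rewrite mevalB mevalXU mevalC; apply => w -> /=.
    by rewrite mevalB mevalXU mevalC subrr.
  apply: irreducible_closure; first by exists x.
  (* A constant curve shows that a single point is irreducible. *)
  move=> _ _ -> ->; exists 1, (\row_i (x 0 i)%:P).
  have E t : ratpt 1 (\row_i (x 0 i)%:P) t = x.
    by apply/rowP => i; rewrite !mxE !hornerE divr1.
  by split=> [t _|//|//]; [rewrite E| exists 0; rewrite ?E ?hornerE ?oner_eq0..].
have irrD : irreducible_algebraic_set (zariski_closure D).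
  apply: irreducible_closure; first by exists x, t1.
  move=> a b Da Db; exists q, N; split=> //.
  by move=> t qt; exists t.
exists (fun i => if i == 0%N then [set x] else zariski_closure D).
split=> [[|i] //|[|[|i]] // _|[|i] // _] /=.
- by move=> _ ->; rewrite -e1; apply: NV.
- exact: zariski_closure_min.
- have xD : D x by exists t1.
  split; first by move=> _ ->; apply: sub_zariski_closure.
  move=> /(_ y); apply: contra_not xy => yx; apply/esym/yx.
  by apply: sub_zariski_closure; exists t2.
Qed.

(** * Dimension bounds from the growth of the coordinate ring *)

Definition lin_free (K : fieldType) n (Z : set 'rV[K]_n) (s : seq {mpoly K[n]}) :=
  forall c : nat -> K, vanishes Z (\sum_(i < size s) c i *: s`_i) ->
  forall i, (i < size s)%N -> c i = 0.

(** These are the products [f ^ j * h] with [j < m] and [h] in [s]. *)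
Fixpoint times_powers (K : fieldType) n (s : seq {mpoly K[n]}) f m :=
  if m is m'.+1 then s ++ [seq f * h | h <- times_powers s f m'] else [::].

Lemma size_times_powers (K : fieldType) n (s : seq {mpoly K[n]}) f m :
  size (times_powers s f m) = (m * size s)%N.
Proof. by elim: m => //= m IH; rewrite size_cat size_map IH mulSn. Qed.

(** Restricting a relation to [Z] kills the multiples of [f], so the coefficients of [s] vanish.
    What remains is [f] times a shorter relation, and [f] cancels because the ideal of [Z'] is prime
    and does not contain it. *)
Lemma lin_free_times_powers (K : fieldType) n (Z Z' : set 'rV[K]_n) s f m :
  irreducible_algebraic_set Z' -> Z `<=` Z' ->
  vanishes Z f -> ~ vanishes Z' f ->
  lin_free Z s -> lin_free Z' (times_powers s f m).
Proof.
move=> irr sub fZ fZ' frs; elim: m => [//|m IH] c.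
set t := times_powers s f m in IH *.
have -> : \sum_(i < size (times_powers s f m.+1)) c i *: (times_powers s f m.+1)`_i
  = \sum_(i < size s) c i *: s`_i
    + f * \sum_(i < size t) c (size s + i)%N *: t`_i.
  rewrite /= -/t size_cat big_split_ord /= size_map; congr (_ + _).
    by apply: eq_bigr => i _; rewrite nth_cat ltn_ord.
  rewrite mulr_sumr; apply: eq_bigr => i _.
  rewrite nth_cat ltnNge leq_addr /= addKn (nth_map 0) //.
  by rewrite scalerAr.
move=> van.
have cs : forall i, (i < size s)%N -> c i = 0.
  apply: frs => v Zv; have := van v (sub v Zv).
  by rewrite mevalD mevalM (fZ v Zv) mul0r addr0.
have {}van : vanishes Z' (f * \sum_(i < size t) c (size s + i)%N *: t`_i).
  move=> v Zv; rewrite -(van v Zv) mevalD [in RHS]big1 ?meval0 ?add0r //.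
  by move=> i _; rewrite cs // scale0r.
have {}van : vanishes Z' (\sum_(i < size t) c (size s + i)%N *: t`_i).
  by case: (vanishes_prime irr van) => // /fZ'.
have ct := IH (fun i => c (size s + i)%N) van.
move=> i; rewrite /= -/t size_cat size_map => il.
have [/cs //|si] := ltnP i (size s).
by rewrite -(subnKC si); apply: ct; lia.
Qed.

(** [msize] is the degree plus one, whence the successors; each product contains at most [m] factors
    [f]. *)
Lemma msize_times_powers (K : fieldType) n (s : seq {mpoly K[n]}) f m E D :
  (msize f <= D.+1)%N -> (forall h, h \in s -> (msize h <= E.+1)%N) ->
  forall h, h \in times_powers s f m -> (msize h <= (E + m * D).+1)%N.
Proof.
move=> fD sE; elim: m => [//|m IH] h /=; rewrite mem_cat => /orP[/sE|].
  by move=> h1; apply: leq_trans h1 _; rewrite ltnS leq_addr.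
move=> /mapP[g /IH gl ->].
have [->|g0] := eqVneq g 0; first by rewrite mulr0 msize0.
have [->|f0] := eqVneq f 0; first by rewrite mul0r msize0.
rewrite msizeM // mulSn.
move: (msize f) (msize g) (m * D)%N fD gl => a b x; lia.
Qed.

(** At each step of the chain, a polynomial vanishing on the smaller set but not on the larger one
    multiplies the number of independent functions by [m], through its first [m] powers. The degrees
    grow only linearly in [m], as [D] is chosen before [m]. *)
Lemma chain_lin_free (K : fieldType) n (V : set 'rV[K]_n) d Z :
  irreducible_chain V d Z ->
  exists D, forall m, exists s,
    [/\ lin_free (Z d) s, size s = (m ^ d)%N &
        forall h, h \in s -> (msize h <= (d * m * D).+1)%N].
Proof.
elim: d => [|d IH] [irr sub lt].
  exists 0%N => m; exists [:: 1]; split=> //; last first.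
    by move=> h; rewrite inE => /eqP ->; rewrite msize1.
  move=> c van [|//] _; have [_ [v Zv] _] := irr 0%N (leqnn 0).
  by have := van v Zv; rewrite big_ord1 /= mevalZ meval1 mulr1.
have [|D HD] := IH.
  split=> i il; [exact: irr (leqW il)|exact: sub (leqW il)|exact: lt (leqW il)].
have [sZ nsZ] := lt d (ltnSn d).
have [f [fZ fZ']] : exists f, vanishes (Z d) f /\ ~ vanishes (Z d.+1) f.
  have [[S ZS] _ _] := irr d (leqnSn d).
  apply: contrapT => /forallNP h; apply: nsZ => v Zv; rewrite ZS => p Sp.
  apply/eqP/negPn/negP => pv; apply: (h p); split.
    by move=> w; rewrite ZS; apply.
  by move=> /(_ v Zv)/eqP; apply/negP.
exists (D + msize f)%N => m; have [s [frs ss sl]] := HD m.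
exists (times_powers s f m); split.
- exact: lin_free_times_powers (irr _ (leqnn _)) sZ fZ fZ' frs.
- by rewrite size_times_powers ss expnS.
- move=> h /(msize_times_powers (leqnSn _) sl) hl; apply: leq_trans hl _.
  rewrite ltnS mulnDr; apply: leq_add; first by rewrite !leq_mul.
  by rewrite leq_mul // leq_pmull.
Qed.

(** A bound on the Hilbert function of [V]; the spanning functions may be arbitrary, which leaves
    room for monomials in other coordinates. *)
Definition growth_le (K : fieldType) n (V : set 'rV[K]_n) (g : nat -> nat) :=
  forall N, exists2 s : seq ('rV[K]_n -> K), (size s <= g N)%N &
  forall p : {mpoly K[n]}, (msize p <= N.+1)%N ->
  exists c : nat -> K, forall v, V v ->
    mev p v = \sum_(i < size s) c i * nth (fun=> 0) s i v.

(** Were [s] longer than the spanning list, the matrix [M] of its coordinates would have a non-zero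
    left kernel vector, that is, a relation among [s] on [V]. *)
Lemma lin_free_growth (K : fieldType) n (V Z : set 'rV[K]_n) g s N :
  growth_le V g -> Z `<=` V -> lin_free Z s ->
  (forall h, h \in s -> (msize h <= N.+1)%N) -> (size s <= g N)%N.
Proof.
move=> gV ZV frs sN; have [b bg bP] := gV N.
apply: leq_trans bg; rewrite leqNgt; apply/negP => lt_bs.
have /choice[c cP] : forall i : 'I_(size s), exists c : nat -> K,
    forall v, V v -> mev s`_i v = \sum_(j < size b) c j * nth (fun=> 0) b j v.
  by move=> i; apply/bP/sN/mem_nth.
pose M := \matrix_(i < size s, j < size b) c i j.
have : kermx M != 0.
  by rewrite -mxrank_eq0 mxrank_ker subn_eq0 -ltnNge (leq_ltn_trans (rank_leq_col _)).
move=> /rowV0Pn[u /sub_kermxP uM u0].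
case/negP: u0; apply/eqP/rowP => i; rewrite mxE.
(* The kernel vector, extended by 0 to all natural indices as [lin_free] requires. *)
pose l k := if insub k is Some j then u 0 j else 0.
have lE (j : 'I_(size s)) : l j = u 0 j.
  by rewrite /l insubT //= => ?; congr (u 0 _); apply: val_inj.
rewrite -lE; apply: frs (ltn_ord i) => v Zv.
rewrite raddf_sum /=.
transitivity (\sum_(j < size b) (u *m M) 0 j * nth (fun=> 0) b j v); last first.
  by rewrite uM big1 // => j _; rewrite mxE mul0r.
transitivity (\sum_(k < size s) \sum_(j < size b) u 0 k * M k j * nth (fun=> 0) b j v).
  apply: eq_bigr => k _; rewrite mevalZ lE cP; last exact: ZV.
  by rewrite mulr_sumr; apply: eq_bigr => j _; rewrite mulrA mxE.
rewrite exchange_big /=; apply: eq_bigr => j _.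
by rewrite mxE mulr_suml.
Qed.

(** A chain of length [e] gives [m ^ e] independent functions of degree O(m), while the growth bound
    allows only O(m^d) of them. *)
Lemma chain_length_growth (K : fieldType) n (V : set 'rV[K]_n) d a :
  growth_le V (fun N => a * N.+1 ^ d)%N ->
  forall e Z, irreducible_chain V e Z -> (e <= d)%N.
Proof.
move=> gV e Z chZ; rewrite leqNgt; apply/negP => de.
have [D HD] := chain_lin_free chZ; have [_ subV _] := chZ.
(* With this [q] the degrees stay below [m * q], and [m > a * q ^ d] gives
   [a * (m * q) ^ d < m ^ d.+1 <= m ^ e]. *)
pose q := (e * D).+1; pose m := (a * q ^ d).+1.
have [s [frs ss sl]] := HD m.
have := lin_free_growth gV (subV _ (leqnn _)) frs sl; rewrite ss leqNgt => /negP; apply.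
have mq : ((e * m * D).+1 <= m * q)%N by rewrite /q /m; lia.
apply: (@leq_ltn_trans (a * (m * q) ^ d)).
  rewrite leq_mul2l; case: (d) => [|k]; first by rewrite orbT.
  by rewrite leq_exp2r // mq orbT.
rewrite -(subnKC (ltnW de)) expnMn expnD mulnCA ltn_mul2l expn_gt0 /=.
apply: (@leq_trans m); first by rewrite /m.
by rewrite -{1}(expn1 m) leq_pexp2l // subn_gt0.
Qed.

Lemma irreducible_chain_widen (K : fieldType) n (V : set 'rV[K]_n) d e Z :
  (d <= e)%N -> irreducible_chain V e Z -> irreducible_chain V d Z.
Proof.
move=> de [irr sub lt]; split=> i il.
- exact: irr (leq_trans il de).
- exact: sub (leq_trans il de).
- exact: lt (leq_trans il de).
Qed.

(** * Curves of solutions *)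

Lemma ord2P (P : 'I_2 -> Prop) : P 0 -> P 1 -> forall i, P i.
Proof.
move=> P0 P1 [[|[|//]] lt_i].
  by rewrite (_ : Ordinal _ = 0) //; apply: val_inj.
by rewrite (_ : Ordinal _ = 1) //; apply: val_inj.
Qed.

Lemma sum2E (R : nmodType) (F : 'I_2 -> R) : \sum_i F i = F 0 + F 1.
Proof.
rewrite big_ord_recl big_ord1; congr (_ + F _); exact: val_inj.
Qed.

Lemma mulmx2E (R : pzRingType) m n (A : 'M[R]_(m, 2)) (B : 'M_(2, n)) i j :
  (A *m B) i j = A i 0 * B 0 j + A i 1 * B 1 j.
Proof. by rewrite mxE sum2E. Qed.

Lemma mulmx1E (R : pzRingType) m n (A : 'M[R]_(m, 1)) (B : 'M_(1, n)) i j :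
  (A *m B) i j = A i 0 * B 0 j.
Proof. by rewrite mxE big_ord1. Qed.

Lemma matrix2P (R : Type) (A B : 'M[R]_2) :
  A 0 0 = B 0 0 -> A 0 1 = B 0 1 -> A 1 0 = B 1 0 -> A 1 1 = B 1 1 -> A = B.
Proof. by move=> *; apply/matrixP; do 2 apply: ord2P. Qed.

Lemma delta_mx_neq0 (K : fieldType) (i j : 'I_2) : delta_mx i j != 0 :> 'M[K]_2.
Proof.
by apply/eqP => /matrixP/(_ i j)/eqP; rewrite !mxE !eqxx oner_eq0.
Qed.

Lemma col2P (R : Type) (u v : 'cV[R]_2) : u 0 0 = v 0 0 -> u 1 0 = v 1 0 -> u = v.
Proof. by move=> *; apply/colP; apply: ord2P. Qed.

(** Cramer's rule: the determinant vanishes only if [u2] is a multiple of [u1]. *)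
Lemma col2_span (K : fieldType) (u1 u2 u : 'cV[K]_2) :
  u1 != 0 -> (forall c, u2 <> c *: u1) -> exists a b, u = a *: u1 + b *: u2.
Proof.
move=> u10 npar.
have d0 : u1 0 0 * u2 1 0 - u2 0 0 * u1 1 0 != 0.
  apply/eqP => d0.
  have [x0|x0] := eqVneq (u1 0 0) 0; last first.
    apply: (npar (u2 0 0 / u1 0 0)); apply: col2P; rewrite !mxE; first by field.
    move/eqP: d0; rewrite subr_eq0 => /eqP d0.
    by rewrite mulrAC -d0; field.
  have [y0|y0] := eqVneq (u1 1 0) 0.
    by case/eqP: u10; apply: col2P; rewrite !mxE.
  apply: (npar (u2 1 0 / u1 1 0)); apply: col2P; rewrite !mxE; last by field.
  move/eqP: d0; rewrite subr_eq0 => /eqP d0.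
  by rewrite mulrAC [_ * u1 0 0]mulrC d0; field.
exists ((u 0 0 * u2 1 0 - u2 0 0 * u 1 0) / (u1 0 0 * u2 1 0 - u2 0 0 * u1 1 0)).
exists ((u1 0 0 * u 1 0 - u 0 0 * u1 1 0) / (u1 0 0 * u2 1 0 - u2 0 0 * u1 1 0)).
by apply: col2P; rewrite !mxE; field.
Qed.

Lemma exists_nonparallel (K : fieldType) (u : 'cV[K]_2) :
  exists w : 'cV[K]_2, forall c, w <> c *: u.
Proof.
have [x0|x0] := eqVneq (u 0 0) 0.
  exists (\col_i (i == 0)%:R) => c /colP/(_ 0).
  by rewrite !mxE x0 mulr0 => /eqP; rewrite oner_eq0.
exists (\col_i (i == 1)%:R) => c E.
have := congr1 (fun v : 'cV_2 => v 0 0) E; have := congr1 (fun v : 'cV_2 => v 1 0) E.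
rewrite !mxE /= => E1 /esym/eqP; rewrite mulf_eq0 (negPf x0) orbF => /eqP c0.
by move/eqP: E1; rewrite c0 mul0r oner_eq0.
Qed.

(** An eigenvector with two non-zero components along independent eigenvectors [u1], [u2] forces all
    three eigenvalues to agree, hence [P] to be scalar. With fewer than two eigenlines the spare
    vectors are fillers. *)
Lemma eigenlines2 (K : fieldType) (P : 'M[K]_2) :
  (forall l, P <> l%:M) ->
  exists u1 u2 : 'cV[K]_2, forall u l, u != 0 -> P *m u = l *: u ->
    exists c, u = c *: u1 \/ u = c *: u2.
Proof.
move=> nsc.
have [[u1 [l1 [u10 E1]]]|no1] :=
  pselect (exists (u : 'cV[K]_2) l, u != 0 /\ P *m u = l *: u); last first.
  by exists 0, 0 => u l u0 E; case: no1; exists u, l.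
have [[u2 [l2 [npar E2]]]|no2] :=
  pselect (exists (u : 'cV[K]_2) l, (forall c, u <> c *: u1) /\ P *m u = l *: u); last first.
  exists u1, u1 => u l u0 E; apply: contrapT => /forallNP h; apply: no2.
  by exists u, l; split=> // c e; apply: (h c); left.
exists u1, u2 => u l u0 E.
have [a [b ue]] := col2_span u u10 npar.
have [a0|a0] := eqVneq a 0; first by exists b; right; rewrite ue a0 scale0r add0r.
have [b0|b0] := eqVneq b 0; first by exists a; left; rewrite ue b0 scale0r addr0.
have u2ne : u2 != 0.
  by apply/eqP => u20; apply: (npar 0); rewrite scale0r.
have key : a *: ((l1 - l) *: u1) + b *: ((l2 - l) *: u2) = 0.
  move/eqP: E; rewrite -subr_eq0 ue mulmxDr -!scalemxAr E1 E2 => /eqP <-.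
  by apply: col2P; rewrite !mxE; ring.
have ll2 : l2 = l.
  apply/eqP; rewrite -subr_eq0; apply/negPn/negP => n0.
  apply: (npar (- (a * (l1 - l)) / (b * (l2 - l)))).
  move/eqP: key; rewrite addr_eq0 => /eqP key.
  have : (b * (l2 - l)) *: u2 = - (a * (l1 - l)) *: u1.
    by rewrite -!scalerA scaleNr -scalerA key opprK.
  move=> /(congr1 (fun w => (b * (l2 - l))^-1 *: w)).
  by rewrite !scalerA mulVf ?mulf_neq0 // scale1r mulrC.
have ll1 : l1 = l.
  apply/eqP; rewrite -subr_eq0; move/eqP: key.
  by rewrite ll2 subrr scale0r scaler0 addr0 !scaler_eq0 (negPf a0) (negPf u10) orbF.
case: (nsc l); apply/eqP; rewrite -subr_eq0; apply/eqP.
have Pw (w : 'cV_2) : (P - l%:M) *m w = 0.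
  have [c [d ->]] := col2_span w u10 npar.
  rewrite mulmxBl mul_scalar_mx mulmxDr -!scalemxAr E1 E2 ll1 ll2.
  by apply: col2P; rewrite !mxE; ring.
by apply/matrixP => i j; have := congr1 (fun w : 'cV_2 => w i 0) (Pw (delta_mx j 0));
  rewrite -colE !mxE.
Qed.

(** Multiplying by the inverse of [Y] on both sides makes the equation affine in that inverse. *)
Lemma riccati_solutions_unit (K : fieldType) (A P Q Y : 'M[K]_2) :
  Y \in unitmx -> riccati_solutions A P Q 0 Y <->
  A + invmx Y *m P + Q *m invmx Y = 0.
Proof.
move=> uY; rewrite /riccati_solutions /= addr0; split=> E.
  have := congr1 (fun M => invmx Y *m M *m invmx Y) E.
  rewrite mulmx0 mul0mx => <-; rewrite !mulmxDr !mulmxDl !mulmxA mulVmx //.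
  by rewrite !mul1mx -!mulmxA mulmxV // !mulmx1.
have := congr1 (fun M => Y *m M *m Y) E.
rewrite mulmx0 mul0mx => <-; rewrite !mulmxDr !mulmxDl !mulmxA mulmxV //.
by rewrite !mul1mx -!mulmxA mulVmx // !mulmx1.
Qed.

Section Curves.
Variable K : numFieldType.
Implicit Types (A P Q X Y : 'M[K]_2) (V : set 'M[K]_2).

Definition ratmx (q : {poly K}) (N : 'M[{poly K}]_2) (t : K) : 'M[K]_2 :=
  map_mx (fun p => p.[t] / q.[t]) N.

Definition has_curve V := exists q N t1 t2,
  [/\ forall t, q.[t] != 0 -> V (ratmx q N t), q.[t1] != 0, q.[t2] != 0 &
      ratmx q N t1 <> ratmx q N t2].

Lemma has_curve_joined V : has_curve V ->
  exists x y, joined_in (mxvec @` V) x y /\ x <> y.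
Proof.
move=> [q [N [t1 [t2 [NV q1 q2 ne]]]]].
exists (mxvec (ratmx q N t1)), (mxvec (ratmx q N t2)); split; last first.
  by move=> /(can_inj mxvecK).
have E t : ratpt q (mxvec N) t = mxvec (ratmx q N t).
  by rewrite /ratmx -map_mxvec; apply/rowP => i; rewrite !mxE.
exists q, (mxvec N); split.
- by move=> t qt; rewrite E; exists (ratmx q N t) => //; apply: NV.
- by exists t1.
- by exists t2.
Qed.

Lemma has_curve_trmx V : has_curve [set Y | V Y^T] -> has_curve V.
Proof.
move=> [q [N [t1 [t2 [NV q1 q2 ne]]]]]; exists q, N^T, t1, t2.
have E t : ratmx q N^T t = (ratmx q N t)^T by rewrite /ratmx map_trmx.
split=> // [t qt|]; first by rewrite E; apply: NV.
by rewrite !E => /trmx_inj.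
Qed.

Lemma has_curve_shift V X : has_curve [set Y | V (X + Y)] -> has_curve V.
Proof.
move=> [q [N [t1 [t2 [NV q1 q2 ne]]]]].
exists q, (q *: map_mx polyC X + N), t1, t2.
have E t : q.[t] != 0 ->
    ratmx q (q *: map_mx polyC X + N) t = X + ratmx q N t.
  by move=> qt; apply/matrixP => i j; rewrite !mxE !hornerE mulrDl mulrAC divff // mul1r.
split=> // [t qt|]; first by rewrite E //; apply: NV.
by rewrite !E // => /addrI.
Qed.

(** The inverses of solutions obey an affine condition, so the line [Z] through [Z1] and [Z2]
    satisfies it. Inverting it by [\adj Z / \det Z] yields a rational curve passing through [Y1] at
    0 and [Y2] at 1. *)
Lemma curve_invertible A P Q Y1 Y2 :
  Y1 \in unitmx -> Y2 \in unitmx -> Y1 <> Y2 ->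
  riccati_solutions A P Q 0 Y1 -> riccati_solutions A P Q 0 Y2 ->
  has_curve (riccati_solutions A P Q 0).
Proof.
have lin := @riccati_solutions_unit _ A P Q.
move=> u1 u2 ne /(lin _ u1) E1 /(lin _ u2) E2.
pose Z1 := invmx Y1; pose Z2 := invmx Y2.
pose Z : 'M[{poly K}]_2 := map_mx polyC Z1 + 'X *: map_mx polyC (Z2 - Z1).
have ZE t : map_mx (horner_eval t) Z = Z1 + t *: (Z2 - Z1).
  by apply/matrixP => i j; rewrite !mxE /horner_eval !hornerE.
have NE t : (\det Z).[t] != 0 ->
    (Z1 + t *: (Z2 - Z1)) \in unitmx /\
    ratmx (\det Z) (\adj Z) t = invmx (Z1 + t *: (Z2 - Z1)).
  move=> dt; have dE : (\det Z).[t] = \det (Z1 + t *: (Z2 - Z1)).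
    by rewrite -ZE -[LHS]/(horner_eval t (\det Z)) -det_map_mx.
  have uZ : Z1 + t *: (Z2 - Z1) \in unitmx by rewrite unitmxE -dE unitfE.
  split=> //; rewrite /invmx uZ -dE -ZE -map_mx_adj.
  by apply/matrixP => i j; rewrite !mxE /horner_eval mulrC.
have d0 : (\det Z).[0] != 0.
  have -> : (\det Z).[0] = \det Z1.
    by rewrite -[LHS]/(horner_eval 0 (\det Z)) -det_map_mx ZE scale0r addr0.
  by rewrite -unitfE -unitmxE unitmx_inv.
have d1 : (\det Z).[1] != 0.
  have -> : (\det Z).[1] = \det Z2.
    by rewrite -[LHS]/(horner_eval 1 (\det Z)) -det_map_mx ZE scale1r addrC subrK.
  by rewrite -unitfE -unitmxE unitmx_inv.
exists (\det Z), (\adj Z), 0, 1; split=> // [t dt|].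
  have [uZ ->] := NE t dt; apply/lin; first by rewrite unitmx_inv.
  rewrite invmxK.
  have -> : A + (Z1 + t *: (Z2 - Z1)) *m P + Q *m (Z1 + t *: (Z2 - Z1)) =
     (1 - t) *: (A + Z1 *m P + Q *m Z1) + t *: (A + Z2 *m P + Q *m Z2).
    by apply: matrix2P; rewrite !(mulmx2E, mxE); ring.
  by rewrite E1 E2 !scaler0 addr0.
rewrite (NE _ d0).2 (NE _ d1).2 scale0r scale1r addr0 addrC subrK !invmxK.
exact: ne.
Qed.

(** Once the quadratic term vanishes the remaining equation is linear, so all multiples of [Y] are
    solutions. *)
Lemma curve_line A P Q Y : Y != 0 -> Y *m A *m Y = 0 ->
  riccati_solutions A P Q 0 Y -> has_curve (riccati_solutions A P Q 0).
Proof.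
move=> Y0 YAY; rewrite /riccati_solutions /= addr0 YAY add0r => E.
exists 1, ('X *: map_mx polyC Y), 0, 1.
have RE t : ratmx 1 ('X *: map_mx polyC Y) t = t *: Y.
  by apply/matrixP => i j; rewrite !mxE !hornerE divr1.
split; rewrite ?hornerE ?oner_eq0 //; first move=> t _.
  rewrite RE /riccati_solutions /= addr0 -!scalemxAl -!scalemxAr YAY !scaler0 add0r.
  by rewrite -scalerDr E scaler0.
by rewrite !RE scale0r scale1r => /esym/eqP; apply/negP.
Qed.

(** Cancelling [u] leaves [(k + l) v + v Q = 0] with [k = v A u], where [u] enters only through [k].
    So [u] may be replaced by another vector [w], rescaled by [k / (v A w)] to restore [k]. *)
Lemma curve_scalar A Q l (u : 'cV[K]_2) (v : 'rV[K]_2) : v != 0 -> u != 0 ->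
  v *m A *m u != 0 -> riccati_solutions A l%:M Q 0 (u *m v) ->
  has_curve (riccati_solutions A l%:M Q 0).
Proof.
move=> v0 u0; set k := (v *m A *m u) 0 0 => k0.
have {}k0 : k != 0.
  by apply: contraNneq k0 => k0; apply/eqP/matrixP => i j; rewrite !ord1 [RHS]mxE.
have form w : v *m A *m w = ((v *m A *m w) 0 0)%:M by rewrite [LHS]mx11_scalar.
rewrite /riccati_solutions /= addr0 => E.
have {}E : k *: v + l *: v + v *m Q = 0.
  have : u *m (k *: v + l *: v + v *m Q) = 0.
    rewrite -[RHS]E !mulmxDr -!scalemxAr mul_scalar_mx -!mulmxA; congr (_ + _ + _).
    by rewrite [A *m _]mulmxA [v *m _]mulmxA [v *m _]mulmxA form mul_scalar_mx -scalemxAr.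
  move: (k *: v + _ + _) => w E'; apply/rowP => j; rewrite mxE.
  have /cV0Pn[i ui] := u0; apply: (mulfI ui).
  by have := congr1 (fun M : 'M_2 => M i j) E'; rewrite mulmx1E !mxE mulr0.
have [u' npar] := exists_nonparallel u.
pose q : {poly K} := k%:P + ((v *m A *m u') 0 0)%:P * 'X.
pose N : 'M[{poly K}]_2 := k%:P *: (map_mx polyC u + 'X *: map_mx polyC u') *m map_mx polyC v.
pose w t := u + t *: u'.
have qE t : q.[t] = (v *m A *m w t) 0 0.
  by rewrite mulmxDr -scalemxAr [RHS]mxE [X in _ = _ + X]mxE /q !hornerE [_ * t]mulrC.
have NE t : ratmx q N t = (k / q.[t]) *: (w t *m v).
  by apply/matrixP => i j; rewrite /ratmx /N -scalemxAl !(mulmx1E, mxE) !hornerE /=; ring.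
have q0 : q.[0] = k by rewrite /q !hornerE.
(* The factor ['X] keeps [t2] away from 0, the parameter of the given solution. *)
have [t2] : exists t, ('X * q).[t] != 0.
  apply: poly_nonroot; rewrite mulf_neq0 ?polyX_eq0 //.
  by apply: contraNneq k0 => qq; rewrite -q0 qq horner0.
rewrite hornerE hornerX mulf_eq0 negb_or => /andP[t20 qt2].
exists q, N, 0, t2; split=> //; rewrite ?q0 //.
  move=> t qt; rewrite NE /riccati_solutions /= addr0.
  set s := k / q.[t]; set y := w t *m v.
  have yAy : y *m A *m y = q.[t] *: y.
    rewrite /y -!mulmxA [A *m _]mulmxA [v *m _]mulmxA [v *m (A *m _)]mulmxA form -qE.
    by rewrite mul_scalar_mx -scalemxAr.
  have yQ : l%:M *m y + y *m Q = - (k *: y).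
    apply/eqP; rewrite -addr_eq0; apply/eqP.
    rewrite -[RHS](mulmx0 _ (w t)) -E !mulmxDr -!scalemxAr mulmxA -/y mul_scalar_mx.
    by rewrite addrC addrA.
  rewrite -addrA -!scalemxAl -!scalemxAr yAy -scalerDr yQ.
  rewrite -scaleNr !scalerA -scalerDl.
  by rewrite [X in X *: _](_ : _ = 0) ?scale0r // /s mulrN -mulrA divfK // subrr.
rewrite !NE q0 divff // scale1r /w scale0r addr0 => E'.
have /rV0Pn[j vj] := v0.
have {}E' : u = (k / q.[t2]) *: (u + t2 *: u').
  apply/colP => i; apply: (mulIf vj).
  by have := congr1 (fun M : 'M_2 => M i j) E'; rewrite !(mulmx1E, mxE) !mulrA.
have s0 : k / q.[t2] != 0 by rewrite mulf_neq0 ?invr_eq0.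
apply: (npar (((k / q.[t2])^-1 - 1) / t2)).
apply: (scalerI t20); rewrite scalerA mulrCA divff // mulr1 scalerBl scale1r.
by rewrite {1}E' scalerA mulVf // scale1r addrC addKr.
Qed.
End Curves.

Lemma rank1_factor (K : fieldType) (Y : 'M[K]_2) : Y \notin unitmx ->
  exists (u : 'cV_2) (v : 'rV_2), Y = u *m v.
Proof.
rewrite -row_free_unit /row_free => r2.
have := mulmx_base Y; have := rank_leq_row Y.
move: (\rank Y) r2 (col_base Y) (row_base Y) => [|[|[|//]]] //= _ u v _ <-.
  by exists 0, 0; rewrite mul0mx; apply/matrixP => i j; rewrite !mxE big_ord0.
by exists u, v.
Qed.

(** * At most six solutions in the absence of a curve *)

Section FinitelyManySolutions.
Variable K : numFieldType.
Implicit Types (A P Q X Y : 'M[K]_2).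

Lemma riccati_solutions_trmx A P Q Y :
  riccati_solutions A P Q 0 Y <-> riccati_solutions A^T Q^T P^T 0 Y^T.
Proof.
rewrite /riccati_solutions /= !addr0.
have -> : Y^T *m A^T *m Y^T + Q^T *m Y^T + Y^T *m P^T =
    (Y *m A *m Y + P *m Y + Y *m Q)^T.
  by rewrite !linearD /= !trmx_mul mulmxA addrAC.
by split => [->|/(congr1 trmx)]; rewrite ?trmxK trmx0.
Qed.

(** Either the quadratic term vanishes and the multiples form a line, or one vector can be moved;
    transposition turns a scalar [Q] into a scalar [P]. *)
Lemma curve_rank1 A P Q (u : 'cV[K]_2) (v : 'rV[K]_2) :
  (exists l, P = l%:M) \/ (exists l, Q = l%:M) -> u *m v != 0 ->
  riccati_solutions A P Q 0 (u *m v) -> has_curve (riccati_solutions A P Q 0).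
Proof.
move=> sc Y0 sol.
have u0 : u != 0 by apply: contraNneq Y0 => ->; rewrite mul0mx.
have v0 : v != 0 by apply: contraNneq Y0 => ->; rewrite mulmx0.
have [YAY|vAu] := eqVneq (v *m A *m u) 0.
  apply: curve_line Y0 _ sol.
  by rewrite -!mulmxA [A *m _]mulmxA [v *m _]mulmxA [v *m _]mulmxA YAY mul0mx mulmx0.
case: sc => -[l e]; subst; first exact: curve_scalar vAu sol.
apply: has_curve_trmx.
have -> : [set Y | riccati_solutions A P l%:M 0 Y^T] = riccati_solutions A^T l%:M P^T 0.
  apply/seteqP; split => Y /=.
    by move/riccati_solutions_trmx; rewrite trmxK tr_scalar_mx.
  by move=> h; apply/riccati_solutions_trmx; rewrite trmxK tr_scalar_mx.
apply: (@curve_scalar _ _ _ _ v^T u^T); rewrite ?trmx_eq0 //.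
  by rewrite -!trmx_mul trmx_eq0 mulmxA.
by move/riccati_solutions_trmx: sol; rewrite trmx_mul tr_scalar_mx.
Qed.

(** For a non-zero solution [e *: M], dividing by [e] gives [e *: (M A M) = - (P M + M Q)]. As
    [M A M] is non-zero, this determines [e]. *)
Lemma solutions_on_line A P Q M :
  (forall Y, Y != 0 -> riccati_solutions A P Q 0 Y -> Y *m A *m Y != 0) ->
  exists Y0, forall c, c *: M != 0 -> riccati_solutions A P Q 0 (c *: M) ->
    c *: M = Y0.
Proof.
move=> nz.
have [[c [c0 sc]]|no] := pselect (exists c, c *: M != 0 /\
    riccati_solutions A P Q 0 (c *: M)); last first.
  by exists 0 => c c0 sc; case: no; exists c.
exists (c *: M) => d d0 sd.
have E e : riccati_solutions A P Q 0 (e *: M) -> e *: M != 0 ->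
    e *: (M *m A *m M) = - (P *m M + M *m Q).
  rewrite scaler_eq0 negb_or => se /andP[e0 _]; apply: (scalerI e0).
  apply/eqP; rewrite scalerN -addr_eq0; apply/eqP.
  move: se; rewrite /riccati_solutions /= addr0 => <-.
  by rewrite -!scalemxAl -!scalemxAr scalerDr addrA.
have := nz _ c0 sc; rewrite -!scalemxAl -!scalemxAr scalerA scaler_eq0 negb_or => /andP[_ M0].
have : (d - c) *: (M *m A *m M) = 0 by rewrite scalerBl !E // subrr.
move/eqP; rewrite scaler_eq0 (negPf M0) orbF subr_eq0 => /eqP -> //.
Qed.

(** All terms other than [P u v] have the left factor [u], so [P u v] has it too; a non-zero entry
    of [v] then exhibits [P u] as a multiple of [u]. *)
Lemma eigen_of_rank1_solution A P Q (u : 'cV[K]_2) (v : 'rV[K]_2) : v != 0 ->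
  riccati_solutions A P Q 0 (u *m v) -> exists l, P *m u = l *: u.
Proof.
move=> /rV0Pn[j vj]; rewrite /riccati_solutions /= addr0 => E.
pose w := v *m A *m u *m v + v *m Q.
have {}E : P *m u *m v = - (u *m w).
  apply/eqP; rewrite -addr_eq0 -[X in _ == X]E mulmxDr !mulmxA.
  by rewrite addrCA addrA.
exists (- (w 0 j / v 0 j)); apply/colP => i; apply: (mulIf vj).
have := congr1 (fun M : 'M_2 => M i j) E.
rewrite mulmx1E [X in _ = X -> _]mxE mulmx1E => ->; rewrite [X in _ = X * _]mxE.
by rewrite mulrAC mulNr divfK // mulNr mulrC.
Qed.

Lemma homogeneous_riccati_dichotomy A P Q :
  has_curve (riccati_solutions A P Q 0) \/
  exists2 s : seq 'M[K]_2, (size s <= 6)%N &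
    riccati_solutions A P Q 0 `<=` [set` s].
Proof.
set V := riccati_solutions A P Q 0.
have [|nocurve] := pselect (has_curve V); [by left|right].
have nz Y : Y != 0 -> V Y -> Y *m A *m Y != 0.
  by move=> Y0 VY; apply/eqP => YAY; apply: nocurve; apply: curve_line Y0 YAY VY.
(* Two invertible solutions would give a curve, so there is at most one; [Yi] is 0 if there is
   none. *)
have [Yi invY] : exists Yi, forall Y, Y \in unitmx -> V Y -> Y = Yi.
  have [[Yi [ui Vi]]|no] := pselect (exists Y, Y \in unitmx /\ V Y); last first.
    by exists 0 => Y uY VY; case: no; exists Y.
  exists Yi => Y uY VY; apply: contrapT => ne; apply: nocurve.
  exact: curve_invertible uY ui ne VY Vi.
have [sc|nsc] := pselect ((exists l, P = l%:M) \/ (exists l, Q = l%:M)).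
  (* Here any solution of rank one would yield a curve. *)
  exists [:: 0; Yi] => // Y VY; rewrite /= !inE.
  have [//|Y0] := eqVneq Y 0.
  have [uY|/rank1_factor[u [v Yuv]]] := boolP (Y \in unitmx).
    by rewrite (invY _ uY VY) eqxx ?orbT.
  by case: nocurve; rewrite Yuv in Y0 VY; apply: curve_rank1 sc Y0 VY.
have [u1 [u2 uP]] : exists u1 u2 : 'cV[K]_2, forall u l, u != 0 -> P *m u = l *: u ->
    exists c, u = c *: u1 \/ u = c *: u2.
  by apply: eigenlines2 => l Pl; apply: nsc; left; exists l.
have [v1 [v2 vP]] : exists u1 u2 : 'cV[K]_2, forall u l, u != 0 -> Q^T *m u = l *: u ->
    exists c, u = c *: u1 \/ u = c *: u2.
  apply: eigenlines2 => l /(congr1 trmx); rewrite trmxK tr_scalar_mx => Ql.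
  by apply: nsc; right; exists l.
(* One candidate for each pair of an eigenline of [P] and one of [Q^T]. *)
have [Y11 H11] := solutions_on_line (u1 *m v1^T) nz.
have [Y12 H12] := solutions_on_line (u1 *m v2^T) nz.
have [Y21 H21] := solutions_on_line (u2 *m v1^T) nz.
have [Y22 H22] := solutions_on_line (u2 *m v2^T) nz.
exists [:: 0; Yi; Y11; Y12; Y21; Y22] => // Y VY; rewrite /= !inE.
have [//|Y0] := eqVneq Y 0.
have [uY|/rank1_factor[u [v Yuv]]] := boolP (Y \in unitmx).
  by rewrite (invY _ uY VY) eqxx ?orbT.
have u0 : u != 0 by apply: contraNneq Y0 => u0; rewrite Yuv u0 mul0mx.
have v0 : v != 0 by apply: contraNneq Y0 => v0; rewrite Yuv v0 mulmx0.
rewrite Yuv in VY Y0 *.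
have [l El] := eigen_of_rank1_solution v0 VY.
have [m Em] : exists m, Q^T *m v^T = m *: v^T.
  apply: (@eigen_of_rank1_solution A^T _ P^T _ u^T); first by rewrite trmx_eq0.
  by rewrite -trmx_mul; apply: (riccati_solutions_trmx A P Q (u *m v)).1.
have [c uE] := uP u l u0 El.
have [|d vE] := vP v^T m _ Em; first by rewrite trmx_eq0.
have {}vE : v = d *: v1^T \/ v = d *: v2^T.
  by case: vE => /(congr1 trmx); rewrite trmxK linearZ /=; [left|right].
case: uE vE VY Y0 => -> [] ->; rewrite -scalemxAl -scalemxAr scalerA => VY Y0.
- by rewrite (H11 _ Y0 VY) eqxx !orbT.
- by rewrite (H12 _ Y0 VY) eqxx !orbT.
- by rewrite (H21 _ Y0 VY) eqxx !orbT.
- by rewrite (H22 _ Y0 VY) eqxx !orbT.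
Qed.

(** Translation by a solution removes the constant term; the cross terms [X A Y] and [Y A X] join
    the linear ones. *)
Lemma riccati_solutions_shift A B1 B2 C X Y : riccati_solutions A B1 B2 C X ->
  riccati_solutions A B1 B2 C (X + Y) <->
  riccati_solutions A (B1 + X *m A) (B2 + A *m X) 0 Y.
Proof.
rewrite /riccati_solutions /= => E.
suff -> : (X + Y) *m A *m (X + Y) + B1 *m (X + Y) + (X + Y) *m B2 + C =
  Y *m A *m Y + (B1 + X *m A) *m Y + Y *m (B2 + A *m X) + 0 by [].
rewrite -E !(mulmxDl, mulmxDr) !mulmxA.
move: (X *m A *m X) (X *m A *m Y) (Y *m A *m X) (Y *m A *m Y) => a b c d.
move: (B1 *m X) (B1 *m Y) (X *m B2) (Y *m B2) => e f g h.
by apply/matrixP => i j; rewrite !mxE; ring.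
Qed.

Lemma riccati_dichotomy A B1 B2 C :
  has_curve (riccati_solutions A B1 B2 C) \/
  exists2 s : seq 'M[K]_2, (size s <= 6)%N &
    riccati_solutions A B1 B2 C `<=` [set` s].
Proof.
have [[X VX]|no] := pselect (exists X, riccati_solutions A B1 B2 C X); last first.
  by right; exists [::] => // X VX; case: no; exists X.
have shift Y := riccati_solutions_shift Y VX.
have [cur|[s s6 sV]] := homogeneous_riccati_dichotomy A (B1 + X *m A) (B2 + A *m X).
  left; apply: (@has_curve_shift _ _ X); rewrite (_ : mkset _ =
    riccati_solutions A (B1 + X *m A) (B2 + A *m X) 0) //.
  by apply/seteqP; split=> Y; [move=> /(shift Y).1|move=> /(shift Y).2].
right; exists [seq X + Y | Y <- s]; first by rewrite size_map.
move=> Y VY; apply/mapP; exists (Y - X); last by rewrite addrC subrK.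
by apply: sV; apply: (shift _).1; rewrite addrC subrK.
Qed.
End FinitelyManySolutions.

(** * Standard monomials on the set of solutions *)

Section LinearSpan.
Variables (K : fieldType) (T : Type) (V : set T).
Implicit Types (f g h : T -> K) (G H L : set (T -> K)).

(* Functions are only compared on [V]. *)
Inductive lspan G : (T -> K) -> Prop :=
| lspan0 f : (forall v, V v -> f v = 0) -> lspan G f
| lspan_cons f c g h : G g -> lspan G h ->
    (forall v, V v -> f v = c * g v + h v) -> lspan G f.

Lemma lspan_eq G f g : (forall v, V v -> f v = g v) -> lspan G f -> lspan G g.
Proof.
move=> fg Gf; case: Gf fg => [{}f f0|{}f c a h Ga Gh fE] fg.
  by apply: lspan0 => v Vv; rewrite -fg ?f0.
by apply: lspan_cons Ga Gh _ => v Vv; rewrite -fg ?fE.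
Qed.

Lemma lspan_gen G g : G g -> lspan G g.
Proof.
move=> Gg; apply: (lspan_cons (c := 1) (h := fun=> 0) Gg).
  exact: lspan0.
by move=> v _; rewrite mul1r addr0.
Qed.

Lemma lspanD G f g : lspan G f -> lspan G g -> lspan G (fun v => f v + g v).
Proof.
move=> Gf Gg; elim: Gf => [{}f f0|{}f c a h Ga _ IH fE].
  by apply: lspan_eq Gg => v Vv; rewrite f0 // add0r.
by apply: lspan_cons Ga IH _ => v Vv; rewrite fE // addrA.
Qed.

Lemma lspanZ G c f : lspan G f -> lspan G (fun v => c * f v).
Proof.
elim=> [{}f f0|{}f d a h Ga _ IH fE].
  by apply: lspan0 => v Vv; rewrite f0 // mulr0.
by apply: (lspan_cons (c := c * d)) Ga IH _ => v Vv; rewrite fE // mulrDr mulrA.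
Qed.

Lemma lspan_sum G (I : eqType) (r : seq I) (F : I -> T -> K) :
  (forall i, i \in r -> lspan G (F i)) -> lspan G (fun v => \sum_(i <- r) F i v).
Proof.
elim: r => [|i r IH] GF; first by apply: lspan0 => v _; rewrite big_nil.
have Gi := GF i (mem_head _ _).
have Gr := IH (fun j jr => GF j (@mem_behead _ (i :: r) j jr)).
by apply: lspan_eq (lspanD Gi Gr) => v _; rewrite big_cons.
Qed.

Lemma lspan_trans G H f :
  (forall g, G g -> lspan H g) -> lspan G f -> lspan H f.
Proof.
move=> GH; elim=> [{}f f0|{}f c a h /GH Ha _ IH fE]; first exact: lspan0.
by apply: lspan_eq (lspanD (lspanZ c Ha) IH) => v Vv; rewrite fE.
Qed.

Lemma lspanM G H L f g :
  (forall a b, G a -> H b -> lspan L (fun v => a v * b v)) ->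
  lspan G f -> lspan H g -> lspan L (fun v => f v * g v).
Proof.
move=> GHL Gf Hg.
have La a : G a -> lspan L (fun v => a v * g v).
  move=> Ga; elim: Hg => [{}g g0|{}g d b k Hb _ IHg gE].
    by apply: lspan0 => v Vv; rewrite g0 // mulr0.
  apply: lspan_eq (lspanD (lspanZ d (GHL _ _ Ga Hb)) IHg) => v Vv.
  by rewrite gE // mulrDr mulrCA.
elim: Gf => [{}f f0|{}f c a h /La aL _ IH fE].
  by apply: lspan0 => v Vv; rewrite f0 // mul0r.
apply: lspan_eq (lspanD (lspanZ c aL) IH) => v Vv.
by rewrite fE // mulrDl mulrA.
Qed.

Lemma lspan_seq (s : seq (T -> K)) f :
  lspan [set nth (fun=> 0) s i | i in [set i | (i < size s)%N]] f ->
  exists c : nat -> K, forall v, V v ->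
    f v = \sum_(i < size s) c i * nth (fun=> 0) s i v.
Proof.
elim=> [{}f f0|{}f d _ h [i /= il <-] _ [c hE] fE].
  by exists (fun=> 0) => v Vv; rewrite f0 // big1 // => i _; rewrite mul0r.
exists (fun j => (if j == i then d else 0) + c j) => v Vv.
rewrite fE // hE //; under [RHS]eq_bigr do rewrite mulrDl.
rewrite big_split /=; congr (_ + _).
rewrite (bigD1 (Ordinal il)) //= eqxx big1 ?addr0 // => j /negPf ji.
by rewrite [(j : nat) == i]ji mul0r.
Qed.
End LinearSpan.

Section StandardMonomials.
Variables (K : fieldType) (T : Type) (V : set T) (a b c e : T -> K).

Definition mon (m : nat * nat * nat * nat) (v : T) : K :=
  let: (i, j, k, l) := m in a v ^+ i * b v ^+ j * c v ^+ k * e v ^+ l.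

(* The weights are chosen so that in both normal forms of the equation the
   leading monomials (a^2, ab, ac, bc, resp. a^2, be, ce, e^2) strictly
   dominate the other terms of their relations. *)
Definition weight (m : nat * nat * nat * nat) : nat :=
  let: (i, j, k, l) := m in (5 * i + 4 * j + 4 * k + 6 * l)%N.

Definition mulm (m n : nat * nat * nat * nat) :=
  let: (i, j, k, l) := m in let: (i', j', k', l') := n in
  (i + i', j + j', k + k', l + l')%N.

Definition mons_lt w : set (T -> K) := [set mon m | m in [set m | (weight m < w)%N]].

(** Includes every monomial that avoids the leading monomials of either normal form; each family
    leaves at most two exponents unbounded, whence quadratic growth. *)
Definition std (m : nat * nat * nat * nat) : bool :=
  let: (i, j, k, l) := m in
  [|| (i <= 1)%N && (l == 0)%N, [&& i == 1, j == 0 & k == 0]%N,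
      (i == 0)%N && (j == 0)%N | (i == 0)%N && (k == 0)%N].

Lemma mon_mulm m n v : mon (mulm m n) v = mon m v * mon n v.
Proof.
by case: m n => [[[i j] k] l] [[[i' j'] k'] l']; rewrite /= !exprD; ring.
Qed.

Lemma weight_mulm m n : weight (mulm m n) = (weight m + weight n)%N.
Proof. by case: m n => [[[i j] k] l] [[[i' j'] k'] l'] /=; lia. Qed.

Lemma mons_ltW w w' f : (w <= w')%N ->
  lspan V (mons_lt w) f -> lspan V (mons_lt w') f.
Proof.
move=> ww; apply: lspan_trans => _ [m /= mw <-]; apply: lspan_gen.
by exists m => //=; apply: leq_trans mw ww.
Qed.

Lemma mons_ltM w w' f g : lspan V (mons_lt w.+1) f ->
  lspan V (mons_lt w'.+1) g -> lspan V (mons_lt (w + w').+1) (fun v => f v * g v).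
Proof.
apply: lspanM => _ _ [m /= mw <-] [n /= nw <-].
apply: lspan_eq (_ : lspan V _ (mon (mulm m n))) => [v _|].
  exact: mon_mulm.
by apply: lspan_gen; exists (mulm m n) => //=; rewrite weight_mulm; lia.
Qed.

(** The heaviest coordinate, [e], has weight 6. *)
Lemma lspan_linear k0 k1 k2 k3 k4 :
  lspan V (mons_lt 7) (fun v => k0 + k1 * a v + k2 * b v + k3 * c v + k4 * e v).
Proof.
have M m : (weight m < 7)%N -> lspan V (mons_lt 7) (mon m).
  by move=> mw; apply: lspan_gen; exists m.
apply: lspan_eq (lspanD (lspanD (lspanD (lspanD (lspanZ k0 (M (0, 0, 0, 0)%N isT))
  (lspanZ k1 (M (1, 0, 0, 0)%N isT))) (lspanZ k2 (M (0, 1, 0, 0)%N isT)))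
  (lspanZ k3 (M (0, 0, 1, 0)%N isT))) (lspanZ k4 (M (0, 0, 0, 1)%N isT))).
by move=> v _ /=; ring.
Qed.

Hypothesis reducible : forall m, ~~ std m -> exists m1 m2,
  m = mulm m1 m2 /\ lspan V (mons_lt (weight m2)) (mon m2).

(** Division by the relations: replacing the factor [m2] by lighter monomials lowers the weight of
    the whole monomial, so strong induction on the weight applies. *)
Lemma lspan_std m :
  lspan V [set mon n | n in [set n | std n && (weight n <= weight m)%N]] (mon m).
Proof.
have [w] := ubnP (weight m); elim: w m => // w IH m mw.
have [sm|/reducible[m1 [m2 [mE red]]]] := boolP (std m).
  by apply: lspan_gen; exists m => //=; rewrite sm leqnn.
have : lspan V (mons_lt (weight m)) (mon m).
  have m1s : lspan V [set mon m1] (mon m1) by apply: lspan_gen.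
  apply: lspan_eq (lspanM _ m1s red) => [v _|_ _ -> [n /= nw <-]].
    by rewrite mE mon_mulm.
  apply: lspan_eq (_ : lspan V _ (mon (mulm m1 n))) => [v _|].
    exact: mon_mulm.
  apply: lspan_gen; exists (mulm m1 n) => //=.
  by rewrite mE !weight_mulm ltn_add2l.
apply: lspan_trans => _ [n /= nw <-].
apply: lspan_trans (IH n _) => [_ [k /= /andP[sk kn] <-]|]; last first.
  exact: leq_trans nw _.
apply: lspan_gen; exists k => //=; rewrite sk.
exact: leq_trans kn (ltnW nw).
Qed.

(** An overcount of the standard exponents of weight at most [N], possibly with repetitions: all
    weights of coordinates exceed 1, so each exponent is at most [N]. *)
Definition std_exps N : seq (nat * nat * nat * nat) :=
  let I := iota 0 N.+1 in
  [seq (0, i, j, 0)%N | i <- I, j <- I] ++ [seq (1, i, j, 0)%N | i <- I, j <- I] ++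
  [seq (0, 0, i, j)%N | i <- I, j <- I] ++ [seq (0, i, 0, j)%N | i <- I, j <- I] ++
  [seq (1, 0, 0, j)%N | j <- I].

Lemma size_std_exps N : (size (std_exps N) <= 5 * N.+1 ^ 2)%N.
Proof. rewrite !size_cat !size_allpairs !size_map ?size_iota -mulnn; nia. Qed.

Lemma mem_std_exps N n : std n -> (weight n <= N)%N -> n \in std_exps N.
Proof.
have inI i : (i <= N)%N -> i \in iota 0 N.+1 by move=> iN; rewrite mem_iota.
rewrite /std_exps; move: (iota 0 N.+1) inI => I inI.
case: n => [[[i j] k] l]; rewrite !mem_cat.
move=> /or4P[/andP[i1 /eqP ->]|/and3P[/eqP -> /eqP -> /eqP ->]|
  /andP[/eqP -> /eqP ->]|/andP[/eqP -> /eqP ->]] nN; rewrite /weight in nN.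
- have [jN kN] : (j <= N)%N /\ (k <= N)%N by lia.
  case: i i1 {nN} => [|[|//]] _.
    by rewrite (allpairs_f (fun i j => (0, i, j, 0)%N) (inI _ jN) (inI _ kN)).
  by rewrite (allpairs_f (fun i j => (1, i, j, 0)%N) (inI _ jN) (inI _ kN)) orbT.
- have lN : (l <= N)%N by lia.
  by rewrite (map_f (fun j => (1, 0, 0, j)%N) (inI _ lN)) !orbT.
- have [kN lN] : (k <= N)%N /\ (l <= N)%N by lia.
  by rewrite (allpairs_f (fun i j => (0, 0, i, j)%N) (inI _ kN) (inI _ lN)) !orbT.
- have [jN lN] : (j <= N)%N /\ (l <= N)%N by lia.
  by rewrite (allpairs_f (fun i j => (0, i, 0, j)%N) (inI _ jN) (inI _ lN)) !orbT.
Qed.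

Lemma mons_lt_std_exps N f : lspan V (mons_lt N.+1) f ->
  exists k : nat -> K, forall v, V v -> f v =
    \sum_(i < size (map mon (std_exps N))) k i * nth (fun=> 0) (map mon (std_exps N)) i v.
Proof.
move=> fN; apply: lspan_seq; apply: lspan_trans fN => _ [m mN <-].
apply: lspan_trans (lspan_std m) => _ [n /andP[sn nm] <-].
have := mem_std_exps sn (leq_trans nm mN).
move: (std_exps N) => s ns; apply: lspan_gen.
have nsz : (index n s < size (map mon s))%N by rewrite size_map index_mem.
exists (index n s); first exact: nsz.
by rewrite (nth_map (0, 0, 0, 0)%N) ?index_mem // nth_index.
Qed.
End StandardMonomials.

(** Each original coordinate has weight at most 6, so degree [N] means weight at most [6 * N], and
    [5 * (6 * N + 1) ^ 2 <= 180 * N.+1 ^ 2]. *)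
Lemma growth_le_std (K : fieldType) n (V : set 'rV[K]_n) (a b c e : 'rV[K]_n -> K) :
  (forall i, lspan V (mons_lt a b c e 7) (fun v => v 0 i)) ->
  (forall m, ~~ std m -> exists m1 m2, m = mulm m1 m2 /\
    lspan V (mons_lt a b c e (weight m2)) (mon a b c e m2)) ->
  growth_le V (fun N => 180 * N.+1 ^ 2)%N.
Proof.
move=> coordP red N.
exists (map (mon a b c e) (std_exps (6 * N))).
  rewrite size_map; apply: leq_trans (size_std_exps _) _; lia.
move=> p pN; apply: mons_lt_std_exps => //.
apply: lspan_eq (_ : lspan V _
    (fun v => \sum_(m <- msupp p) p@_m * \prod_i v 0 i ^+ m i)) => [v _|].
  by rewrite mevalE.
have one : lspan V (mons_lt a b c e 1) (fun=> 1).
  apply: lspan_eq (_ : lspan V _ (mon a b c e (0, 0, 0, 0)%N)) => [v _|].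
    by rewrite /= !mulr1.
  by apply: lspan_gen; exists (0, 0, 0, 0)%N.
have pow i k : lspan V (mons_lt a b c e (6 * k).+1) (fun v => v 0 i ^+ k).
  elim: k => [|k IH]; first exact: one.
  by rewrite mulnS; apply: lspan_eq (mons_ltM (coordP i) IH) => v _; rewrite exprS.
have prod (m : 'X_{1.. n}) (r : seq 'I_n) :
    lspan V (mons_lt a b c e (6 * \sum_(i <- r) m i).+1)
      (fun v => \prod_(i <- r) v 0 i ^+ m i).
  elim: r => [|i r IH].
    by rewrite big_nil; apply: lspan_eq one => v _; rewrite big_nil.
  rewrite big_cons mulnDr; apply: lspan_eq (mons_ltM (pow i (m i)) IH) => v _.
  by rewrite big_cons.
apply: lspan_sum => m ms; apply: lspanZ; apply: mons_ltW (prod m _).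
by rewrite ltnS leq_mul2l /= -mdegE -ltnS (leq_trans (msize_mdeg_lt ms)).
Qed.

(** * Rewriting rules for the two normal forms of [A] *)

Section NormalForms.
Variables (K : fieldType) (T : Type) (V : set T) (a b c d : T -> K).
Variables P Q C : 'M[K]_2.

(** For [A = diag(1, 0)] the quadratic parts of the four entries are [a^2], [ab], [ca], [cb]: each
    equals a linear polynomial, of weight at most 6. *)
Lemma reducible_rank1 :
  (forall v, V v -> [/\
    a v * a v + (P 0 0 * a v + P 0 1 * c v) +
      (a v * Q 0 0 + b v * Q 1 0) + C 0 0 = 0,
    a v * b v + (P 0 0 * b v + P 0 1 * d v) +
      (a v * Q 0 1 + b v * Q 1 1) + C 0 1 = 0,
    c v * a v + (P 1 0 * a v + P 1 1 * c v) +
      (c v * Q 0 0 + d v * Q 1 0) + C 1 0 = 0 &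
    c v * b v + (P 1 0 * b v + P 1 1 * d v) +
      (c v * Q 0 1 + d v * Q 1 1) + C 1 1 = 0]) ->
  forall m, ~~ std m -> exists m1 m2, m = mulm m1 m2 /\
    lspan V (mons_lt a b c d (weight m2)) (mon a b c d m2).
Proof.
move=> rel.
have lin k0 k1 k2 k3 k4 := lspan_linear V a b c d k0 k1 k2 k3 k4.
have aa : lspan V (mons_lt a b c d 10) (mon a b c d (2, 0, 0, 0)%N).
  apply: (mons_ltW (w := 7)) => //.
  apply: lspan_eq (lin (- C 0 0) (- (P 0 0 + Q 0 0)) (- Q 1 0) (- P 0 1) 0)
    => v /rel[E _ _ _] /=.
  by apply/eqP; rewrite eq_sym -subr_eq0; apply/eqP; rewrite -[RHS]E; ring.
have ab : lspan V (mons_lt a b c d 9) (mon a b c d (1, 1, 0, 0)%N).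
  apply: (mons_ltW (w := 7)) => //.
  apply: lspan_eq (lin (- C 0 1) (- Q 0 1) (- (P 0 0 + Q 1 1)) 0 (- P 0 1))
    => v /rel[_ E _ _] /=.
  by apply/eqP; rewrite eq_sym -subr_eq0; apply/eqP; rewrite -[RHS]E; ring.
have ac : lspan V (mons_lt a b c d 9) (mon a b c d (1, 0, 1, 0)%N).
  apply: (mons_ltW (w := 7)) => //.
  apply: lspan_eq (lin (- C 1 0) (- P 1 0) 0 (- (P 1 1 + Q 0 0)) (- Q 1 0))
    => v /rel[_ _ E _] /=.
  by apply/eqP; rewrite eq_sym -subr_eq0; apply/eqP; rewrite -[RHS]E; ring.
have bc : lspan V (mons_lt a b c d 8) (mon a b c d (0, 1, 1, 0)%N).
  apply: (mons_ltW (w := 7)) => //.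
  apply: lspan_eq (lin (- C 1 1) 0 (- P 1 0) (- Q 0 1) (- (P 1 1 + Q 1 1)))
    => v /rel[_ _ _ E] /=.
  by apply/eqP; rewrite eq_sym -subr_eq0; apply/eqP; rewrite -[RHS]E; ring.
move=> [[[i j] k] l] ns.
have [i2|i1] := leqP 2 i.
  by exists (i - 2, j, k, l)%N, (2, 0, 0, 0)%N; split=> //=; rewrite subnK // !addn0.
have [/andP[i0 j0]|nab] := boolP ((0 < i) && (0 < j))%N.
  by exists (i - 1, j - 1, k, l)%N, (1, 1, 0, 0)%N; split=> //=; rewrite !subnK // !addn0.
have [/andP[i0 k0]|nac] := boolP ((0 < i) && (0 < k))%N.
  by exists (i - 1, j, k - 1, l)%N, (1, 0, 1, 0)%N; split=> //=; rewrite !subnK // !addn0.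
have [/andP[j0 k0]|nbc] := boolP ((0 < j) && (0 < k))%N.
  by exists (i, j - 1, k - 1, l)%N, (0, 1, 1, 0)%N; split=> //=; rewrite !subnK // !addn0.
by exfalso; move: ns nab nac nbc; rewrite /std; lia.
Qed.

(* The entries off the diagonal involve a and d through b (a + d) and c (a + d),
   and the difference of the diagonal ones through (d - a) (d + a); hence the
   fourth coordinate a + d instead of d. *)
Lemma reducible_rank2 :
  (forall v, V v -> [/\
    a v * a v + b v * c v + (P 0 0 * a v + P 0 1 * c v) +
      (a v * Q 0 0 + b v * Q 1 0) + C 0 0 = 0,
    a v * b v + b v * d v + (P 0 0 * b v + P 0 1 * d v) +
      (a v * Q 0 1 + b v * Q 1 1) + C 0 1 = 0,
    c v * a v + d v * c v + (P 1 0 * a v + P 1 1 * c v) +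
      (c v * Q 0 0 + d v * Q 1 0) + C 1 0 = 0 &
    c v * b v + d v * d v + (P 1 0 * b v + P 1 1 * d v) +
      (c v * Q 0 1 + d v * Q 1 1) + C 1 1 = 0]) ->
  let e v := a v + d v in
  forall m, ~~ std m -> exists m1 m2, m = mulm m1 m2 /\
    lspan V (mons_lt a b c e (weight m2)) (mon a b c e m2).
Proof.
move=> rel e.
have lin k0 k1 k2 k3 k4 := lspan_linear V a b c e k0 k1 k2 k3 k4.
have bc : lspan V (mons_lt a b c e 10) (mon a b c e (0, 1, 1, 0)%N).
  by apply: lspan_gen; exists (0, 1, 1, 0)%N.
have ae : lspan V (mons_lt a b c e 12) (mon a b c e (1, 0, 0, 1)%N).
  by apply: lspan_gen; exists (1, 0, 0, 1)%N.
(* The upper left entry gives [a^2 = - bc] plus linear terms, and [bc] has weight 8 against 10. *)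
have aa : lspan V (mons_lt a b c e 10) (mon a b c e (2, 0, 0, 0)%N).
  have l10 := mons_ltW (isT : 7 <= 10)%N
    (lin (- C 0 0) (- (P 0 0 + Q 0 0)) (- Q 1 0) (- P 0 1) 0).
  apply: lspan_eq (lspanD (lspanZ (-1) bc) l10)
    => v /rel[E _ _ _] /=.
  by apply/eqP; rewrite eq_sym -subr_eq0; apply/eqP; rewrite -[RHS]E; ring.
have be : lspan V (mons_lt a b c e 10) (mon a b c e (0, 1, 0, 1)%N).
  apply: (mons_ltW (w := 7)) => //.
  apply: lspan_eq (lin (- C 0 1) (- Q 0 1 + P 0 1) (- (P 0 0 + Q 1 1)) 0 (- P 0 1))
    => v /rel[_ E _ _] /=.
  by apply/eqP; rewrite eq_sym -subr_eq0; apply/eqP; rewrite -[RHS]E /e; ring.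
have ce : lspan V (mons_lt a b c e 10) (mon a b c e (0, 0, 1, 1)%N).
  apply: (mons_ltW (w := 7)) => //.
  apply: lspan_eq (lin (- C 1 0) (- P 1 0 + Q 1 0) 0 (- (P 1 1 + Q 0 0)) (- Q 1 0))
    => v /rel[_ _ E _] /=.
  by apply/eqP; rewrite eq_sym -subr_eq0; apply/eqP; rewrite -[RHS]E /e; ring.
(* Subtracting the diagonal entries gives [d^2 - a^2 = e^2 - 2 ae] up to linear terms; [ae] has
   weight 11 against 12. *)
have ee : lspan V (mons_lt a b c e 12) (mon a b c e (0, 0, 0, 2)%N).
  have l12 := mons_ltW (isT : 7 <= 12)%N
    (lin (C 0 0 - C 1 1) (P 0 0 + Q 0 0 + P 1 1 + Q 1 1)
      (Q 1 0 - P 1 0) (P 0 1 - Q 0 1) (- (P 1 1 + Q 1 1))).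
  apply: lspan_eq (lspanD (lspanZ 2 ae) l12)
    => v /rel[E0 _ _ E1] /=.
  apply/eqP; rewrite eq_sym -subr_eq0; apply/eqP.
  by rewrite -[RHS](subrr 0) -[X in _ = X - _]E1 -[X in _ = _ - X]E0 /e; ring.
move=> [[[i j] k] l] ns.
have [i2|i1] := leqP 2 i.
  by exists (i - 2, j, k, l)%N, (2, 0, 0, 0)%N; split=> //=; rewrite subnK // !addn0.
have [l2|l1] := leqP 2 l.
  by exists (i, j, k, l - 2)%N, (0, 0, 0, 2)%N; split=> //=; rewrite subnK // !addn0.
have [/andP[j0 l0]|nbe] := boolP ((0 < j) && (0 < l))%N.
  by exists (i, j - 1, k, l - 1)%N, (0, 1, 0, 1)%N; split=> //=; rewrite !subnK // !addn0.
have [/andP[k0 l0]|nce] := boolP ((0 < k) && (0 < l))%N.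
  by exists (i, j, k - 1, l - 1)%N, (0, 0, 1, 1)%N; split=> //=; rewrite !subnK // !addn0.
by exfalso; move: ns nbe nce; rewrite /std; lia.
Qed.
End NormalForms.

Lemma riccati_entries (K : fieldType) (Y P Q C : 'M[K]_2) r :
  Y *m pid_mx r *m Y + P *m Y + Y *m Q + C = 0 -> forall i j,
  (0 < r)%N%:R * (Y i 0 * Y 0 j) + (1 < r)%N%:R * (Y i 1 * Y 1 j) +
  (P i 0 * Y 0 j + P i 1 * Y 1 j) + (Y i 0 * Q 0 j + Y i 1 * Q 1 j) + C i j = 0.
Proof.
move=> /matrixP E i j; have := E i j; rewrite !(mulmx2E, mxE) /= => <-; ring.
Qed.

(** Write [A = L D R] with [L], [R] invertible and [D] the diagonal idempotent of the same rank.
    Multiplying the equation by [R] on the left and [L] on the right turns it into one for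
    [Y = R X L] with leading matrix [D]. *)
Lemma riccati_growth (K : fieldType) (A B1 B2 C : 'M[K]_2) : A != 0 ->
  growth_le (mxvec @` riccati_solutions A B1 B2 C) (fun N => 180 * N.+1 ^ 2)%N.
Proof.
move=> A0; pose L := col_ebase A; pose R := row_ebase A; pose r := \rank A.
pose D : 'M[K]_2 := pid_mx r.
have uL : L \in unitmx by apply: col_ebase_unit.
have uR : R \in unitmx by apply: row_ebase_unit.
have AE : A = L *m D *m R by rewrite mulmx_ebase.
have r12 : r = 1%N \/ r = 2%N.
  move: A0 (rank_leq_row A); rewrite -mxrank_eq0 -/r.
  by case: (r) => [|[|[|//]]] // _ _; [left|right].
pose Y (v : 'rV_(2 * 2)) := R *m vec_mx v *m L.
pose P := R *m B1 *m invmx R; pose Q := invmx L *m B2 *m L; pose E := R *m C *m L.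
have rel v : (mxvec @` riccati_solutions A B1 B2 C) v ->
    Y v *m D *m Y v + P *m Y v + Y v *m Q + E = 0.
  move=> [X]; rewrite /riccati_solutions /= => sol <-.
  rewrite /Y mxvecK -[RHS](mul0mx _ L) -[X in X *m L](mulmx0 _ R) -sol.
  rewrite !mulmxDr !mulmxDl /P /Q /E AE !mulmxA; congr (_ + _ + _ + _).
    by rewrite mulmxKV.
  by rewrite mulmxK.
pose f (i j : 'I_2) (v : 'rV[K]_(2 * 2)) : K := Y v i j.
(* The entries of [X] are linear combinations of those of [Y], as [X = R^-1 Y L^-1]. *)
have fcoord G : (forall i j, lspan (mxvec @` riccati_solutions A B1 B2 C) G (f i j)) ->
    forall i, lspan (mxvec @` riccati_solutions A B1 B2 C) G (fun v => v 0 i).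
  move=> fG; case/mxvec_indexP => i j.
  have LY (v : 'rV[K]_(2 * 2)) : v 0 (mxvec_index i j) = \sum_(k < 2) \sum_(l < 2)
      (invmx R i k * invmx L l j) * f k l v.
    rewrite -[in LHS](vec_mxK v) mxvecE.
    have -> : vec_mx v = invmx R *m Y v *m invmx L.
      by rewrite /Y !mulmxA mulVmx // mul1mx mulmxK.
    rewrite /f; move: (Y v) (invmx R) (invmx L) => y p q.
    by rewrite !(mulmx2E, sum2E); ring.
  apply: (lspan_eq (f := fun v => \sum_(k < 2) \sum_(l < 2)
      (invmx R i k * invmx L l j) * f k l v)) => [v _|]; first by rewrite LY.
  apply: lspan_sum => k _; apply: lspan_sum => l _; exact: lspanZ.
case: r12 => r12.
- have gen m : (weight m < 7)%N -> lspan (mxvec @` riccati_solutions A B1 B2 C)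
      (mons_lt (f 0 0) (f 0 1) (f 1 0) (f 1 1) 7) (mon (f 0 0) (f 0 1) (f 1 0) (f 1 1) m).
    by move=> mw; apply: lspan_gen; exists m.
  apply: (growth_le_std (a := f 0 0) (b := f 0 1) (c := f 1 0) (e := f 1 1)).
    apply: fcoord; do 2 apply: ord2P.
    + by apply: lspan_eq (gen (1, 0, 0, 0)%N isT) => v _ /=; rewrite !expr0 expr1; ring.
    + by apply: lspan_eq (gen (0, 1, 0, 0)%N isT) => v _ /=; rewrite !expr0 expr1; ring.
    + by apply: lspan_eq (gen (0, 0, 1, 0)%N isT) => v _ /=; rewrite !expr0 expr1; ring.
    + by apply: lspan_eq (gen (0, 0, 0, 1)%N isT) => v _ /=; rewrite !expr0 expr1; ring.
  apply: (@reducible_rank1 _ _ _ _ _ _ _ P Q E) => v /rel.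
  rewrite /D r12 => /riccati_entries rv.
  by split; [rewrite -(rv 0 0)|rewrite -(rv 0 1)|rewrite -(rv 1 0)|rewrite -(rv 1 1)];
    rewrite /f /=; ring.
- pose e v := f 0 0 v + f 1 1 v.
  have gen m : (weight m < 7)%N -> lspan (mxvec @` riccati_solutions A B1 B2 C)
      (mons_lt (f 0 0) (f 0 1) (f 1 0) e 7) (mon (f 0 0) (f 0 1) (f 1 0) e m).
    by move=> mw; apply: lspan_gen; exists m.
  apply: (growth_le_std (a := f 0 0) (b := f 0 1) (c := f 1 0) (e := e)).
    apply: fcoord; do 2 apply: ord2P.
    + by apply: lspan_eq (gen (1, 0, 0, 0)%N isT) => v _ /=; rewrite !expr0 expr1; ring.
    + by apply: lspan_eq (gen (0, 1, 0, 0)%N isT) => v _ /=; rewrite !expr0 expr1; ring.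
    + by apply: lspan_eq (gen (0, 0, 1, 0)%N isT) => v _ /=; rewrite !expr0 expr1; ring.
    (* The lower right entry is recovered as [e - a]. *)
    + apply: lspan_eq (lspanD (gen (0, 0, 0, 1)%N isT) (lspanZ (-1) (gen (1, 0, 0, 0)%N isT))).
      by move=> v _ /=; rewrite !expr0 !expr1 /e; ring.
  apply: (@reducible_rank2 _ _ _ _ _ _ _ P Q E) => v /rel.
  rewrite /D r12 => /riccati_entries rv.
  by split; [rewrite -(rv 0 0)|rewrite -(rv 0 1)|rewrite -(rv 1 0)|rewrite -(rv 1 1)];
    rewrite /f /=; ring.
Qed.

(** * The three possible forms of the solution set *)

Lemma set_seq_nth (T : eqType) (x0 : T) (s : seq T) :
  [set` s] = nth x0 s @` `I_(size s).
Proof.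
apply/seteqP; split=> [x xs|_ [i il <-]]; last exact: mem_nth.
by exists (index x s); rewrite /= ?index_mem // nth_index.
Qed.

Lemma card_uniq_seq (T : eqType) (s : seq T) : uniq s -> [set` s] #= `I_(size s).
Proof.
case: s => [|x0 s'] us; first by rewrite (_ : [set` _] = set0) ?II0 //; apply/seteqP; split.
rewrite (set_seq_nth x0); apply: inj_card_eq => i j; rewrite !inE => il jl /eqP.
by rewrite nth_uniq // => /eqP.
Qed.

(** The equations are the four entries of the left-hand side at the generic matrix [X] of
    indeterminates. *)
Lemma riccati_solutions_algebraic (K : fieldType) (A B1 B2 C : 'M[K]_2) :
  algebraic_set (mxvec @` riccati_solutions A B1 B2 C).
Proof.
pose X : 'M[{mpoly K[2 * 2]}]_2 := \matrix_(i, j) 'X_(mxvec_index i j).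
pose c (M : 'M[K]_2) : 'M[{mpoly K[2 * 2]}]_2 := map_mx (@mpolyC _ _) M.
pose E := X *m c A *m X + c B1 *m X + X *m c B2 + c C.
have evE (v : 'rV[K]_(2 * 2)) : map_mx (meval (fun i => v 0 i)) E =
    vec_mx v *m A *m vec_mx v + B1 *m vec_mx v + vec_mx v *m B2 + C.
  have cE M : map_mx (meval (fun i => v 0 i)) (c M) = M.
    by apply/matrixP => i j; rewrite !mxE mevalC.
  have XE : map_mx (meval (fun i => v 0 i)) X = vec_mx v.
    by apply/matrixP => i j; rewrite !mxE mevalXU.
  by rewrite /E !map_mxD !map_mxM !cE XE.
exists [set E i j | i in setT & j in setT].
apply/seteqP; split => [_ [M sM <-] p [i _ [j _ <-]]|v ev].
  have := congr1 (fun N : 'M_2 => N i j) (evE (mxvec M)).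
  by rewrite mxvecK sM !mxE.
exists (vec_mx v); last by rewrite vec_mxK.
rewrite /riccati_solutions /= -evE; apply/matrixP => i j; rewrite mxE [RHS]mxE.
by apply: ev; exists i => //; exists j.
Qed.

Lemma riccati_chain_le2 (K : fieldType) (A B1 B2 C : 'M[K]_2) : A != 0 ->
  forall e Z, irreducible_chain (mxvec @` riccati_solutions A B1 B2 C) e Z ->
  (e <= 2)%N.
Proof. by move=> /riccati_growth h e Z; apply: chain_length_growth; apply: h. Qed.

(** A curve gives a chain of length 1 and growth excludes length 3; the dimension is 2 or 1
    according to whether a chain of length 2 exists. *)
Lemma riccati_has_curve_dim (K : numFieldType) (A B1 B2 C : 'M[K]_2) : A != 0 ->
  has_curve (riccati_solutions A B1 B2 C) ->
  matrix_algebraic_set_of_dim (riccati_solutions A B1 B2 C) 1 \/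
  matrix_algebraic_set_of_dim (riccati_solutions A B1 B2 C) 2.
Proof.
move=> A0 /has_curve_joined[x [y [xy ne]]].
have alg := riccati_solutions_algebraic A B1 B2 C.
have ch1 := joined_chain1 alg xy ne.
have le2 := riccati_chain_le2 A0.
have [ch2|nch2] := pselect (exists Z,
  irreducible_chain (mxvec @` riccati_solutions A B1 B2 C) 2 Z); [right|left].
  by split=> //; apply: le2.
split=> // e Z chZ; rewrite leqNgt; apply/negP => e1; apply: nch2.
by exists Z; apply: irreducible_chain_widen chZ.
Qed.

Lemma riccati_trichotomy (K : numFieldType) (A B1 B2 C : 'M[K]_2) : A != 0 ->
  [\/ exists2 k : nat, (k <= 6)%N & riccati_solutions A B1 B2 C #= `I_k,
      matrix_algebraic_set_of_dim (riccati_solutions A B1 B2 C) 1 |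
      matrix_algebraic_set_of_dim (riccati_solutions A B1 B2 C) 2].
Proof.
move=> A0; have [|[s s6 sV]] := riccati_dichotomy A B1 B2 C.
  by case/(riccati_has_curve_dim A0); [constructor 2|constructor 3].
constructor 1; have [k Vk] : finite_set (riccati_solutions A B1 B2 C).
  exact: sub_finite_set sV (finite_seq s).
exists k => //; apply: leq_trans s6; rewrite -card_le_II -(card_le_eql Vk).
apply: card_le_trans (subset_card_le sV) _.
by rewrite (set_seq_nth 0); apply: card_image_le.
Qed.

(** * Solution sets of dimension 1 and 2 *)

Lemma line_chain_le1 (K : fieldType) n (V : set 'rV[K]_n) (k : 'I_n -> K) b :
  (forall v, V v -> forall i, v 0 i = k i * b v) ->
  forall e Z, irreducible_chain V e Z -> (e <= 1)%N.
Proof.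
(* On [V] a polynomial of degree at most [N] is one in [b] alone, spanned by [N.+1] powers. *)
move=> Vk; apply: (chain_length_growth (a := 1)) => N.
exists [seq (fun v => b v ^+ j) | j <- iota 0 N.+1].
  by rewrite size_map size_iota mul1n expn1.
move=> p pN; apply: lspan_seq.
apply: (lspan_eq (f := fun v => \sum_(m <- msupp p)
    (p@_m * \prod_i k i ^+ m i) * b v ^+ mdeg m)) => [v Vv|].
  rewrite mevalE; apply: eq_bigr => m _; rewrite -mulrA; congr (_ * _).
  rewrite mdegE -prodrXr -big_split /=; apply: eq_bigr => i _.
  by rewrite (Vk v Vv) exprMn.
apply: lspan_sum => m ms; apply: lspanZ; apply: lspan_gen.
have mN : (mdeg m < N.+1)%N := leq_trans (msize_mdeg_lt ms) pN.
exists (mdeg m); first by rewrite /mkset size_map size_iota.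
by rewrite (nth_map 0%N) ?size_iota // nth_iota.
Qed.

(** For [X] with rows [(a, b)] and [(c, d)] the equations are [a^2 = ab = ca + c = cb + d = 0], so
    exactly [b] is free. *)
Lemma riccati_dim1_example (K : numFieldType) :
  matrix_algebraic_set_of_dim
    (riccati_solutions (delta_mx 0 0) (delta_mx 1 1) 0 0 : set 'M[K]_2) 1.
Proof.
set V := riccati_solutions _ _ _ _.
have alg : algebraic_set (mxvec @` V) by apply: riccati_solutions_algebraic.
have line (Y : 'M[K]_2) : V Y <-> [/\ Y 0 0 = 0, Y 1 0 = 0 & Y 1 1 = 0].
  rewrite /V /riccati_solutions /= !addr0 mulmx0 addr0; split=> [E|[Y00 Y10 Y11]].
    have := congr1 (fun M : 'M_2 => M 0 0) E; rewrite !(mulmx2E, mxE) /= => E00.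
    have := congr1 (fun M : 'M_2 => M 1 0) E; rewrite !(mulmx2E, mxE) /= => E10.
    have := congr1 (fun M : 'M_2 => M 1 1) E; rewrite !(mulmx2E, mxE) /= => E11.
    have Y00 : Y 0 0 = 0.
      by apply/eqP; rewrite -sqrf_eq0; apply/eqP; rewrite -E00; ring.
    have Y10 : Y 1 0 = 0 by rewrite -E10 Y00; ring.
    by split=> //; rewrite -E11 Y10; ring.
  by apply: matrix2P; rewrite !(mulmx2E, mxE) /= ?Y00 ?Y10 ?Y11; ring.
split=> //.
  have /has_curve_joined[x [y [xy ne]]] : has_curve V; last exact: joined_chain1 xy ne.
  apply: (@curve_line _ _ _ _ (delta_mx 0 1)).
  - exact: delta_mx_neq0.
  - by apply: matrix2P; rewrite !(mulmx2E, mxE) /=; ring.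
  - by apply/line; rewrite !mxE.
apply: (line_chain_le1 (b := fun v => vec_mx v 0 1)
  (k := fun i => mxvec (delta_mx 0 1 : 'M[K]_2) 0 i)) => _ [Y /line[Y00 Y10 Y11] <-] i.
rewrite mxvecK; case/mxvec_indexP: i => i j; rewrite !mxvecE mxE.
by move: i j; do 2 apply: ord2P; rewrite /= ?Y00 ?Y10 ?Y11 ?mul0r ?mul1r.
Qed.

Lemma irreducible_linear_closure (K : numFieldType) n (D : set 'rV[K]_n) :
  D 0 -> (forall x y t, D x -> D y -> D (x + t *: (y - x))) ->
  irreducible_algebraic_set (zariski_closure D).
Proof.
move=> D0 lin; apply: irreducible_closure => [|x y Dx Dy]; first by exists 0.
pose N : 'rV[{poly K}]_n := map_mx polyC x + 'X *: map_mx polyC (y - x).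
have NE t : ratpt 1 N t = x + t *: (y - x).
  by apply/rowP => i; rewrite !mxE !hornerE divr1.
exists 1, N; split=> [t _||]; first by rewrite NE; apply: lin.
- by exists 0; rewrite ?hornerE ?oner_eq0 // NE scale0r addr0.
- by exists 1; rewrite ?hornerE ?oner_eq0 // NE scale1r addrC subrK.
Qed.

(** The equations are [a^2 = ab = ca = cb = 0], whose solutions are the planes [a = b = 0] and
    [a = c = 0]. The chain is a point, a line and the first plane. *)
Lemma riccati_dim2_example (K : numFieldType) :
  matrix_algebraic_set_of_dim
    (riccati_solutions (delta_mx 0 0) 0 0 0 : set 'M[K]_2) 2.
Proof.
set V := riccati_solutions _ _ _ _.
have alg : algebraic_set (mxvec @` V) by apply: riccati_solutions_algebraic.
split=> //; last first.
  exact/riccati_chain_le2/delta_mx_neq0.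
pose D (k : nat) : set 'rV[K]_(2 * 2) := mxvec @` [set Y : 'M[K]_2 |
  [/\ Y 0 0 = 0, Y 0 1 = 0, (k < 1)%N -> Y 1 0 = 0 & (k < 2)%N -> Y 1 1 = 0]].
have DV k : D k `<=` mxvec @` V.
  move=> _ [Y [Y00 Y01 _ _] <-]; exists Y => //.
  rewrite /V /riccati_solutions /= !mul0mx mulmx0 !addr0.
  by apply: matrix2P; rewrite !(mulmx2E, mxE) /= ?Y00 ?Y01; ring.
exists (fun k => zariski_closure (D k)); split=> k kl.
- apply: irreducible_linear_closure =>
    [|_ _ t [X [X00 X01 X10 X11] <-] [Y [Y00 Y01 Y10 Y11] <-]].
    by exists 0; rewrite ?linear0 //; split; rewrite ?mxE.
  exists (X + t *: (Y - X)); last by rewrite linearD linearZ linearB.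
  split; rewrite ?mxE ?X00 ?X01 ?Y00 ?Y01 => *; rewrite ?X10 ?X11 ?Y10 ?Y11 //; ring.
- by apply: zariski_closure_min.
- have DD : D k `<=` D k.+1.
    move=> _ [Y [Y00 Y01 Y10 Y11] <-]; exists Y => //.
    by split=> // h; apply: Y11; lia.
  split.
    apply: zariski_closure_min; first by exists (vanishes (D k.+1)).
    exact: subset_trans DD (@sub_zariski_closure _ _ _).
  have [q [M [MD MM vq]]] : exists q M, [/\ D k.+1 M, mev q M <> 0 & vanishes (D k) q].
    case: k kl {DD} => [|[|//]] _.
      exists 'X_(mxvec_index 1 0), (mxvec (delta_mx 1 0)); split.
      + by exists (delta_mx 1 0) => //; split; rewrite ?mxE.
      + by rewrite mevalXU mxvecE mxE; apply/eqP; rewrite oner_eq0.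
      + by move=> _ [Y [_ _ Y10 _] <-]; rewrite mevalXU mxvecE Y10.
    exists 'X_(mxvec_index 1 1), (mxvec (delta_mx 1 1)); split.
    + by exists (delta_mx 1 1) => //; split; rewrite ?mxE.
    + by rewrite mevalXU mxvecE mxE; apply/eqP; rewrite oner_eq0.
    + by move=> _ [Y [_ _ _ Y11] <-]; rewrite mevalXU mxvecE Y11.
  by move=> /(_ _ (sub_zariski_closure MD))/(_ q vq).
Qed.

(** * Examples with diagonal coefficients *)

Lemma delta_mulmx_delta (R : comPzRingType) (A : 'M[R]_2) i j :
  delta_mx i j *m A *m delta_mx i j = A j i *: delta_mx i j.
Proof.
apply/matrixP; move: i j; do 4 apply: ord2P; rewrite !(mulmx2E, mxE) /=; ring.
Qed.

Section DiagonalExamples.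
Variables (K : numFieldType) (p q : 'rV[K]_2).
(** The eigenvalue of [Y |-> P Y + Y Q] on the matrix unit [delta_mx i j], for [P], [Q] diagonal
    with entries [p], [q]. *)
Let s i j := p 0 i + q 0 j.
Hypothesis s_neq0 : forall i j, s i j != 0.
Hypothesis s_inj : forall i j i' j', s i j = s i' j' -> i = i' /\ j = j'.
Variable A : 'M[K]_2.

(** The unique [Z] with [A + Z P + Q Z = 0], hence the only candidate for the inverse of an
    invertible solution. *)
Let W : 'M[K]_2 := \matrix_(i, j) (- A i j / s j i).
(** The coefficient [k] of the matrix unit solves [k * A j i + s i j = 0]. *)
Let single (x : 'I_2 * 'I_2) : 'M[K]_2 :=
  (- s x.1 x.2 / A x.2 x.1) *: delta_mx x.1 x.2.

Lemma diag_solutionsE Y : riccati_solutions A (diag_mx p) (diag_mx q) 0 Y <->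
  forall i j, (Y *m A *m Y) i j + s i j * Y i j = 0.
Proof.
rewrite /riccati_solutions /= addr0 mul_diag_mx mul_mx_diag; split=> [E i j|E].
  have := congr1 (fun M : 'M_2 => M i j) E.
  by rewrite 2!mxE [X in _ + X + _]mxE [X in _ + X]mxE [RHS]mxE => <-; rewrite /s; ring.
apply/matrixP => i j; rewrite 2!mxE [X in _ + X + _]mxE [X in _ + X]mxE [RHS]mxE.
by rewrite -(E i j) /s; ring.
Qed.

Lemma diag_unit_solutions Y : Y \in unitmx ->
  riccati_solutions A (diag_mx p) (diag_mx q) 0 Y <-> invmx Y = W.
Proof.
move=> uY; apply: iff_trans (riccati_solutions_unit _ _ _ uY) _.
rewrite mul_diag_mx mul_mx_diag; move: (invmx Y) => Z; split=> [E|->].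
  apply/matrixP => i j; rewrite mxE; apply: (mulIf (s_neq0 j i)).
  rewrite divfK //; apply/eqP; rewrite -subr_eq0 opprK; apply/eqP.
  have := congr1 (fun M : 'M_2 => M i j) E.
  by rewrite 2!mxE [X in _ + X + _]mxE [X in _ + X]mxE [RHS]mxE => <-; rewrite /s; ring.
apply/matrixP => i j; rewrite !mxE.
by have := s_neq0 j i; rewrite /s => sn; field.
Qed.

(** A matrix of rank one satisfies [Y A Y = t Y], so [t = - s i j] wherever [Y i j] is non-zero. The
    [s i j] being distinct, [Y] is a multiple of one matrix unit. *)
Lemma diag_singular_solutions Y : Y \notin unitmx -> Y != 0 ->
  riccati_solutions A (diag_mx p) (diag_mx q) 0 Y <->
  exists2 x, A x.2 x.1 != 0 & Y = single x.
Proof.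
move=> /rank1_factor[u [v Yuv]] Y0.
apply: iff_trans (diag_solutionsE Y) _; split=> [sol|[[i j] /= Aji ->] i' j'].
  pose t := (v *m A *m u) 0 0.
  have YAY : Y *m A *m Y = t *: Y.
    rewrite Yuv -!mulmxA [A *m _]mulmxA [v *m _]mulmxA [v *m (A *m _)]mulmxA.
    by rewrite [v *m A *m u]mx11_scalar mul_scalar_mx -scalemxAr.
  have [i [j Yij]] : exists i j, Y i j != 0.
    apply: contrapT => h; case/eqP: Y0; apply/matrixP => i j; rewrite mxE.
    by apply/eqP/negPn/negP => Yij; apply: h; exists i, j.
  have tE i' j' : Y i' j' != 0 -> t = - s i' j'.
    move=> Y'; have := sol i' j'; rewrite YAY mxE -mulrDl => /eqP.
    by rewrite mulf_eq0 (negPf Y') orbF addr_eq0 => /eqP.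
  have YE : Y = Y i j *: delta_mx i j.
    apply/matrixP => i' j'; rewrite !mxE.
    have [Y'|/tE] := eqVneq (Y i' j') 0.
      case: eqVneq => [ii|_]; case: eqVneq => [jj|_]; rewrite ?mulr0 //.
      by rewrite -ii -jj Y' mul0r.
    rewrite (tE i j Yij) => /oppr_inj/s_inj[-> ->].
    by rewrite !eqxx mulr1.
  have Aji : - s i j = A j i * Y i j.
    have := sol i j; rewrite {1 2}YE -!scalemxAl -!scalemxAr delta_mulmx_delta.
    rewrite !mxE !eqxx /= mulr1 => E.
    apply/eqP; rewrite eq_sym -addr_eq0; apply/eqP.
    apply: (mulIf Yij); rewrite mul0r -[RHS]E; ring.
  have A0 : A j i != 0.
    by apply: contraNneq (s_neq0 i j) => A0; rewrite -oppr_eq0 Aji A0 mul0r.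
  exists (i, j) => //; rewrite /single /= {1}YE; congr (_ *: _).
  by rewrite Aji mulrAC divff ?mul1r.
rewrite /single /= -!scalemxAl -!scalemxAr.
rewrite delta_mulmx_delta !mxE.
have [/andP[/eqP -> /eqP ->]|_] := boolP ((i' == i) && (j' == j)).
  by rewrite /=; field.
by rewrite !mulr0 addr0.
Qed.

(** The summands count 0, one solution of rank one per non-zero entry of [A], and the inverse of [W]
    if it exists. *)
Lemma card_diag_solutions :
  riccati_solutions A (diag_mx p) (diag_mx q) 0 #=
  `I_(1 + \sum_i \sum_j (A j i != 0)%R + (W \in unitmx))%N.
Proof.
pose l := [seq single x | x : 'I_2 * 'I_2 in [pred x | A x.2 x.1 != 0]].
pose l' := if W \in unitmx then [:: invmx W] else [::].
have singleE x : single x x.1 x.2 = - s x.1 x.2 / A x.2 x.1.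
  by rewrite !mxE !eqxx mulr1.
have single_unit x : single x \notin unitmx.
  rewrite -row_free_unit /row_free neq_ltn; apply/orP; left.
  by rewrite (leq_ltn_trans (mxrankS (scalemx_sub _ (submx_refl _)))) // mxrank_delta.
have single_neq0 x : A x.2 x.1 != 0 -> single x != 0.
  move=> Ax; apply: contraNneq (s_neq0 x.1 x.2) => /matrixP/(_ x.1 x.2)/eqP.
  by rewrite singleE mxE mulf_eq0 invr_eq0 (negPf Ax) orbF oppr_eq0.
have -> : riccati_solutions A (diag_mx p) (diag_mx q) 0 = [set` 0 :: l ++ l'].
  apply/seteqP; split=> Y /=; rewrite inE mem_cat.
    have [//|Y0 sol] := eqVneq Y 0; have [uY|nuY] := boolP (Y \in unitmx).
      have YW := (diag_unit_solutions uY).1 sol.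
      by rewrite /l' -YW unitmx_inv uY invmxK !inE eqxx orbT.
    have [x Ax ->] := (diag_singular_solutions nuY Y0).1 sol.
    have xl : single x \in l by apply/fintype.imageP; exists x.
    by rewrite xl orbT.
  case/or3P => [/eqP ->|/fintype.imageP[x Ax ->]|].
  - by rewrite /riccati_solutions /= !mulmx0 !mul0mx !addr0.
  - by apply/(diag_singular_solutions (single_unit x) (single_neq0 x Ax)); exists x.
  - rewrite /l'; case: ifP => // uW; rewrite inE => /eqP ->.
    by apply/diag_unit_solutions; rewrite ?unitmx_inv ?invmxK.
have sl : size l = (\sum_i \sum_j (A j i != 0)%R)%N.
  rewrite size_image -sum1_card big_mkcond pair_bigA /=.
  by apply: eq_bigr => -[i j] _ /=; rewrite inE; case: eqP.
have sl' : size l' = (W \in unitmx) by rewrite /l'; case: ifP.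
rewrite (_ : (1 + _ + _)%N = size (0 :: l ++ l')); last first.
  by rewrite [RHS]/= size_cat sl sl' add1n addSn.
apply: card_uniq_seq; rewrite cons_uniq mem_cat negb_or -andbA; apply/and3P; split.
- by apply/negP => /fintype.imageP[x Ax /esym/eqP]; apply/negP/single_neq0.
- rewrite /l'; case: ifP => // uW; rewrite inE; apply: contraTneq uW => W0.
  by rewrite -unitmx_inv -W0 unitmxE det0 unitr0.
rewrite cat_uniq; apply/and3P; split.
- rewrite map_inj_in_uniq ?enum_uniq // => x y; rewrite !mem_enum => Ax _ xy.
  have : single y x.1 x.2 != 0.
    by rewrite -xy singleE mulf_neq0 ?invr_eq0 // oppr_eq0.
  rewrite !mxE; case: (x) (y) => [i j] [i' j'] /=.
  by case: (eqVneq i i') => [->|_]; case: (eqVneq j j') => [->|_] //=; rewrite mulr0 eqxx.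
- rewrite /l'; case: ifP => //= uW; rewrite orbF; apply/negP => /fintype.imageP[x _ xW].
  by have := single_unit x; rewrite -xW unitmx_inv uW.
- by rewrite /l'; case: ifP.
Qed.
End DiagonalExamples.

(** * Solution sets with 0 to 6 elements *)

Lemma det_mx2 (R : comPzRingType) (M : 'M[R]_2) :
  \det M = M 0 0 * M 1 1 - M 0 1 * M 1 0.
Proof.
rewrite (expand_det_row _ 0) sum2E /cofactor !det_mx11 !mxE /=.
rewrite (_ : lift 0 0 = 1); last exact: val_inj.
rewrite (_ : lift 1 0 = 0); last exact: val_inj.
by rewrite expr0 expr1 mul1r mulN1r mulrN.
Qed.

Lemma card_riccati_example (K : numFieldType) (b00 b01 b10 b11 : bool) :
  exists A P Q : 'M[K]_2, [/\ b00 -> A != 0 &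
  riccati_solutions A P Q 0 #=
  `I_(1 + (b00 + b01 + b10 + b11) + (b00 && b11 || b01 && b10))%N].
Proof.
pose A : 'M[K]_2 := \matrix_(i, j)
  (if i == 0 then if j == 0 then b00 else b01 else if j == 0 then b10 else b11)%:R.
(* The four sums [p 0 i + q 0 j] are 1, 2, 3, 4: distinct and non-zero. *)
pose p : 'rV[K]_2 := \row_i i.+1%:R; pose q : 'rV[K]_2 := \row_j (2 * j)%:R.
have sE i j : p 0 i + q 0 j = (i.+1 + 2 * j)%:R by rewrite !mxE natrD.
have s0 i j : p 0 i + q 0 j != 0 by rewrite sE Num.Theory.pnatr_eq0 addSn.
have s_inj i j i' j' : p 0 i + q 0 j = p 0 i' + q 0 j' -> i = i' /\ j = j'.
  rewrite !sE => /eqP; rewrite Num.Theory.eqr_nat => /eqP.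
  have := ltn_ord i; have := ltn_ord i'; have := ltn_ord j; have := ltn_ord j'.
  by move=> *; split; apply: ord_inj; lia.
exists A, (diag_mx p), (diag_mx q); split=> [b|].
  by apply/eqP => /matrixP/(_ 0 0)/eqP; rewrite !mxE b oner_eq0.
have := card_diag_solutions s0 s_inj A; rewrite !sum2E !mxE /=.
rewrite !Num.Theory.pnatr_eq0 !eqb0 !negbK unitmxE det_mx2 !mxE /= unitfE.
(* The determinant of [W] is [b00 b11 / 4 - b01 b10 / 6]; as 3 and 2 differ, it vanishes only if
   both products do. *)
rewrite [X in X != 0](_ : _ = (3 * (b00 && b11)%:R - 2 * (b01 && b10)%:R) / 12); last first.
  have mb (a b : bool) : (a && b)%:R = a%:R * b%:R :> K by rewrite -mulnb natrM.
  rewrite !mb modn_small //; by field.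
rewrite mulf_eq0 invr_eq0 Num.Theory.pnatr_eq0 orbF.
rewrite (_ : (_ != 0) = (b00 && b11 || b01 && b10)); last first.
  case: (b00 && b11); case: (b01 && b10);
    rewrite /= ?mulr0 ?mulr1 ?subr0 ?sub0r ?subrr ?eqxx ?oppr_eq0;
    rewrite ?Num.Theory.pnatr_eq0 //.
  by rewrite (_ : 3 - 2 = 1 :> K) ?oner_eq0 //; ring.
by rewrite (_ : b00 + b01 + b10 + b11 = b00 + b10 + (b01 + b11))%N //; lia.
Qed.

Lemma riccati_cardinals (K : numFieldType) (k : nat) : (k <= 6)%N ->
  exists A B1 B2 C : 'M[K]_2, A != 0 /\ riccati_solutions A B1 B2 C #= `I_k.
Proof.
(* Fixing [b00] as true makes [A] non-zero; this family always has at least two solutions, so 0 and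
   1 are treated apart. *)
have ex (b01 b10 b11 : bool) : exists A B1 B2 C : 'M[K]_2, A != 0 /\
    riccati_solutions A B1 B2 C #= `I_(2 + (b01 + b10 + b11) + (b11 || b01 && b10))%N.
  have [A [P [Q [A0 card]]]] := card_riccati_example K true b01 b10 b11.
  exists A, P, Q, 0; split; first exact: A0.
  by rewrite (_ : 2 + _ = 1 + (1 + b01 + b10 + b11))%N //; lia.
case: k => [|[|[|[|[|[|[|//]]]]]]] _.
(* The first row reads [a^2 = 0] and [ab + 1 = 0], which is contradictory. *)
- exists (delta_mx 0 0), 0, 0, (delta_mx 0 1); split; first exact: delta_mx_neq0.
  rewrite (_ : riccati_solutions _ _ _ _ = set0) ?II0 //; apply/seteqP; split=> // X /= E.
  have := congr1 (fun M : 'M_2 => M 0 0) E; rewrite !(mulmx2E, mxE) /= => E00.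
  have := congr1 (fun M : 'M_2 => M 0 1) E; rewrite !(mulmx2E, mxE) /= => E01.
  have X00 : X 0 0 = 0.
    by apply/eqP; rewrite -sqrf_eq0; apply/eqP; rewrite -E00; ring.
  by move/eqP: (oner_neq0 K); apply; rewrite -E01 X00; ring.
(* The equations [a^2 = ab + b = ca + c = cb + 2d = 0] leave only 0. *)
- exists (delta_mx 0 0), (delta_mx 1 1), (delta_mx 1 1), 0; split; first exact: delta_mx_neq0.
  rewrite (_ : riccati_solutions _ _ _ _ = [set 0]) ?card_set1 //.
  apply/seteqP; split=> [X /= E|_ ->]; last first.
    by rewrite /riccati_solutions /= !mulmx0 !mul0mx !addr0.
  have := congr1 (fun M : 'M_2 => M 0 0) E; rewrite !(mulmx2E, mxE) /= => E00.
  have := congr1 (fun M : 'M_2 => M 0 1) E; rewrite !(mulmx2E, mxE) /= => E01.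
  have := congr1 (fun M : 'M_2 => M 1 0) E; rewrite !(mulmx2E, mxE) /= => E10.
  have := congr1 (fun M : 'M_2 => M 1 1) E; rewrite !(mulmx2E, mxE) /= => E11.
  have X00 : X 0 0 = 0.
    by apply/eqP; rewrite -sqrf_eq0; apply/eqP; rewrite -E00; ring.
  have X01 : X 0 1 = 0 by rewrite -E01 X00; ring.
  have X10 : X 1 0 = 0 by rewrite -E10 X00; ring.
  have X11 : X 1 1 = 0.
    have n2 : 2 != 0 :> K by rewrite Num.Theory.pnatr_eq0.
    by apply: (mulfI n2); rewrite mulr0 -E11 X01 X10; ring.
  by apply: matrix2P; rewrite mxE.
- exact: (ex false false false).
- exact: (ex true false false).
- exact: (ex false false true).
- exact: (ex true true false).
- exact: (ex true true true).
Qed.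

Theorem proposition6 (R : realType) :
  [/\ forall k : nat, (k <= 6)%N ->
        exists A B1 B2 C : 'M[R[i]]_2,
          A != 0 /\ riccati_solutions A B1 B2 C #= `I_k,
      exists A B1 B2 C : 'M[R[i]]_2,
        A != 0 /\ matrix_algebraic_set_of_dim (riccati_solutions A B1 B2 C) 1,
      exists A B1 B2 C : 'M[R[i]]_2,
        A != 0 /\ matrix_algebraic_set_of_dim (riccati_solutions A B1 B2 C) 2 &
      forall A B1 B2 C : 'M[R[i]]_2, A != 0 ->
        [\/ exists2 k : nat, (k <= 6)%N &
              riccati_solutions A B1 B2 C #= `I_k,
            matrix_algebraic_set_of_dim (riccati_solutions A B1 B2 C) 1 |
            matrix_algebraic_set_of_dim (riccati_solutions A B1 B2 C) 2]].
Proof.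
split.
- exact: riccati_cardinals.
- exists (delta_mx 0 0), (delta_mx 1 1), 0, 0; split; first exact: delta_mx_neq0.
  exact: riccati_dim1_example.
- exists (delta_mx 0 0), 0, 0, 0; split; first exact: delta_mx_neq0.
  exact: riccati_dim2_example.
- exact: riccati_trichotomy.
Qed.
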